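(* Let $m=1$ and let $F^1$ and $F_{ii'}=F_{i'i}$ ($i,i'=1,\dots,n$) be $C^\infty$ functions of $(x,w,w_1,\dots,w_n)$. If there exists a Lagrange function $f$ of some finite order (a function of $x$ and finitely many $w_I$) such that $$e^1[f]=F^1-\sum_{i,i'=1}^n F_{ii'}\,w_{ii'},$$ then the conditions $$\frac{\partial F_{ii'}}{\partial w_{i''}}=\frac{\partial F_{ii''}}{\partial w_{i'}}\ \ (i,i',i''=1,\dots,n),\qquad \frac{\partial F^1}{\partial w_{i'}}+\sum_i\frac{\partial F_{ii'}}{\partial x_i}+\sum_i\frac{\partial F_{ii'}}{\partial w}w_i=0\ \ (i'=1,\dots,n)$$ hold; consequently (for data defined on the whole space $\mathbb R^n\times\mathbb R\times\mathbb R^n$) there also exists a first-order Lagrange function $g(x,w,w_1,\dots,w_n)$ with $e^1[g]=F^1-\sum_{i,i'}F_{ii'}w_{ii'}$.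
   Context: One dependent variable $w$, independent variables $x_1,\dots,x_n$; jet coordinates $w_I$ with $I$ a nondecreasing multi-index in $\{1,\dots,n\}$, $w_{ii'}=w_{i'i}$ denoting the second-order coordinate. Total derivative $\frac{d}{dx_i}=\partial_{x_i}+\sum_I w_{Ii}\partial_{w_I}$ ($Ii$ = reordered multi-index), and Euler–Lagrange expression $e^1[f]=\sum_I(-1)^{|I|}\frac{d}{dx_I}\frac{\partial f}{\partial w_I}$. *)

(* Defs.v *)
From Stdlib Require Import Reals List Arith ClassicalEpsilon.
Import ListNotations.
Open Scope R_scope.

(* A point of the (infinite) jet space with one dependent variable w:
   independent coordinates x_0,...,x_{n-1} (paper: x_1..x_n) and jet
   coordinates w_K, K a nondecreasing list of indices (w_[] = w). *)
Record jet := mkJet { jx : nat -> R ; jw : list nat -> R }.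

Inductive coord := X (i : nat) | W (K : list nat).

Definition coord_val (p : jet) (c : coord) : R :=
  match c with X i => jx p i | W K => jw p K end.

Definition upd (p : jet) (c : coord) (t : R) : jet :=
  match c with
  | X i => mkJet (fun j => if Nat.eqb j i then t else jx p j) (jw p)
  | W K => mkJet (jx p)
             (fun J => if list_eq_dec Nat.eq_dec J K then t else jw p J)
  end.

(* the derivative of h at t (meaningful when h is differentiable at t) *)
Definition deriv (h : R -> R) (t : R) : R :=
  epsilon (inhabits 0) (fun l => derivable_pt_lim h t l).

Definition pd (c : coord) (F : jet -> R) (p : jet) : R :=
  deriv (fun t => F (upd p c t)) (coord_val p c).

Definition iter_pd (cs : list coord) (F : jet -> R) : jet -> R :=
  fold_right (fun c G => pd c G) F cs.

Definition sumR {A : Type} (l : list A) (f : A -> R) : R :=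
  fold_right (fun a s => f a + s) 0 l.

Fixpoint all_lists (n j : nat) : list (list nat) :=
  match j with
  | O => [[]]
  | S j' => flat_map (fun i => map (cons i) (all_lists n j')) (seq 0 n)
  end.

Fixpoint nondecr (l : list nat) : bool :=
  match l with
  | a :: ((b :: _) as t) => Nat.leb a b && nondecr t
  | _ => true
  end.

Definition mindices (n k : nat) : list (list nat) :=
  flat_map (fun j => filter nondecr (all_lists n j)) (seq 0 (S k)).

Fixpoint insert (i : nat) (K : list nat) : list nat :=
  match K with
  | [] => [i]
  | a :: K' => if Nat.leb i a then i :: a :: K' else a :: insert i K'
  end.

Definition order_le (n k : nat) (F : jet -> R) : Prop :=
  forall p q, (forall i, (i < n)%nat -> jx p i = jx q i) ->
    (forall K, In K (mindices n k) -> jw p K = jw q K) -> F p = F q.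

Definition admissible (n k : nat) (c : coord) : Prop :=
  match c with X i => (i < n)%nat | W K => In K (mindices n k) end.

Definition jet_cont (n k : nat) (G : jet -> R) : Prop :=
  forall p eps, eps > 0 -> exists delta, delta > 0 /\
    forall q, (forall i, (i < n)%nat -> Rabs (jx q i - jx p i) < delta) ->
      (forall K, In K (mindices n k) -> Rabs (jw q K - jw p K) < delta) ->
      Rabs (G q - G p) < eps.

Definition smooth (n k : nat) (F : jet -> R) : Prop :=
  order_le n k F /\
  forall cs, Forall (admissible n k) cs ->
    jet_cont n k (iter_pd cs F) /\
    forall c, admissible n k c -> forall p,
      exists l, derivable_pt_lim (fun t => iter_pd cs F (upd p c t)) (coord_val p c) l.

(* total derivative d/dx_i, the sum over K truncated at |K| <= N
   (exact for functions of order <= N) *)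
Definition Dtot (n N i : nat) (G : jet -> R) (p : jet) : R :=
  pd (X i) G p + sumR (mindices n N) (fun J => jw p (insert i J) * pd (W J) G p).

Definition Dmulti (n N : nat) (K : list nat) (G : jet -> R) : jet -> R :=
  fold_right (fun i H => Dtot n N i H) G K.

Definition EL (n k : nat) (f : jet -> R) (p : jet) : R :=
  sumR (mindices n k)
    (fun K => (-1) ^ (length K) * Dmulti n (2 * k) K (pd (W K) f) p).

(* Main.v *)
(* Write E f for the Euler-Lagrange expression of f, and let Q_i be the higher
   Euler operator built like E but with each word D_M of total derivatives
   replaced by its Leibniz derivative in the letter D_i.  Integration by parts
   gives E (D_j G) = 0 and Q_i (D_j G) = - [i = j] E G, and commuting d/dw_i past
   D_M gives d/dw_i (E f) = E (f_{w_i}) + Q_i (f_w).  Applying Q_i termwise to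
   E f = sum_K (-1)^|K| D_K f_{w_K} therefore yields Q_i (E f) = d/dw_i (E f), the
   part of the self-adjointness of the linearization of E f that matters here.
   For E f = F1 - sum F_ab w_ab it reads
     d/dw_i F1 + sum_a D_a F_ai = sum_ab (d/dw_i F_ab) w_ab,
   and comparing coefficients of the free coordinates w_ab gives both conditions.
   Conversely, the first condition makes (F_ab) the Hessian in the variables w_a
   of a function g0, by integrating twice a closed family of functions; the
   second one says that F1 minus the first-order part of E g0 is a function of x and
   w alone, hence is E g1 for a primitive g1 in w. *)
From Coquelicot Require Import Coquelicot.
From Stdlib Require Import Lra Lia Classical ClassicalEpsilon FunctionalExtensionality FinFun.
Require Import Defs.
From Stdlib Require Import Reals List Arith.
Import ListNotations.
Open Scope R_scope.

(** * Coordinates and partial derivatives *)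

(** The total derivative is an infinite sum, finite on each function of finite order but with a
    length that grows at every iteration, while [EL] freezes that length at twice the order of [f].
    A fixed truncation respects composition only below a certain order, so the argument runs in
    operators [D], [euler], [euler1] that sum up to the order of their own argument; [EL_euler] is
    the bridge to [EL]. Integration by parts then becomes one identity, [series_D], valid for every
    family of linear operators indexed by words; E, Q_i and the jet part of D_i are all instances.
    The coordinates w_ab and w_ba are one, so comparing coefficients only yields identities
    symmetrized in a and b; the symmetry of F_ab has to undo this. Since [smooth] speaks of all
    iterated derivatives, its stability under products and primitives is proved by exhibiting a
    class of functions closed under differentiation, not by formulas for higher derivatives. *)

Lemma coord_dec (c d : coord) : {c = d} + {c <> d}.
Proof. decide equality; [apply Nat.eq_dec | apply (list_eq_dec Nat.eq_dec)]. Qed.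

Lemma jet_ext (p q : jet) : (forall c, coord_val p c = coord_val q c) -> p = q.
Proof.
  destruct p as [px pw], q as [qx qw]; intros H; f_equal.
  - extensionality i; exact (H (X i)).
  - extensionality K; exact (H (W K)).
Qed.

Lemma coord_val_upd (p : jet) (c d : coord) (t : R) :
  coord_val (upd p c t) d = if coord_dec d c then t else coord_val p d.
Proof.
  destruct (coord_dec d c) as [->|ne]; destruct c as [i|K].
  - simpl; now rewrite Nat.eqb_refl.
  - simpl; now destruct (list_eq_dec Nat.eq_dec K K).
  - destruct d as [j|J]; simpl; auto.
    destruct (Nat.eqb_spec j i); subst; now auto.
  - destruct d as [j|J]; simpl; auto.
    destruct (list_eq_dec Nat.eq_dec J K); subst; now auto.
Qed.

Lemma coord_val_upd_eq (p : jet) (c : coord) (t : R) : coord_val (upd p c t) c = t.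
Proof. rewrite coord_val_upd; now destruct (coord_dec c c). Qed.

Lemma coord_val_upd_neq (p : jet) (c d : coord) (t : R) :
  d <> c -> coord_val (upd p c t) d = coord_val p d.
Proof. rewrite coord_val_upd; now destruct (coord_dec d c). Qed.

Lemma upd_id (p : jet) (c : coord) : upd p c (coord_val p c) = p.
Proof.
  apply jet_ext; intros d; rewrite coord_val_upd.
  now destruct (coord_dec d c) as [->|].
Qed.

Lemma upd_upd (p : jet) (c : coord) (s t : R) : upd (upd p c s) c t = upd p c t.
Proof.
  apply jet_ext; intros d; rewrite !coord_val_upd.
  now destruct (coord_dec d c).
Qed.

Lemma upd_comm (p : jet) (c d : coord) (s t : R) :
  c <> d -> upd (upd p c s) d t = upd (upd p d t) c s.
Proof.
  intros ne; apply jet_ext; intros e; rewrite !coord_val_upd.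
  destruct (coord_dec e d), (coord_dec e c); congruence.
Qed.

(** As [deriv] chooses by [epsilon], an equation about [pd] alone says nothing about
    differentiability. This relation includes existence of the derivative everywhere; the rules of
    calculus are proved for it and passed on to [pd] by [dlim_pd]. *)
Definition dlim (c : coord) (F G : jet -> R) : Prop :=
  forall p, derivable_pt_lim (fun t => F (upd p c t)) (coord_val p c) (G p).

Lemma dlim_pd (c : coord) (F G : jet -> R) : dlim c F G -> pd c F = G.
Proof.
  intros H; extensionality p; unfold pd, deriv.
  apply (uniqueness_limite (fun t => F (upd p c t)) (coord_val p c)); [|apply H].
  apply epsilon_spec; exists (G p); apply H.
Qed.

Lemma dlim_pd_ex (c : coord) (F : jet -> R) :
  (forall p, exists l, derivable_pt_lim (fun t => F (upd p c t)) (coord_val p c) l) ->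
  dlim c F (pd c F).
Proof. intros H p; unfold pd, deriv; apply epsilon_spec, H. Qed.

Lemma dlim_at (c : coord) (F G : jet -> R) (p : jet) (t : R) :
  dlim c F G -> is_derive (fun s => F (upd p c s)) t (G (upd p c t)).
Proof.
  intros H; apply is_derive_Reals.
  specialize (H (upd p c t)); rewrite coord_val_upd_eq in H.
  assert (E : (fun s => F (upd (upd p c t) c s)) = (fun s => F (upd p c s))).
  { extensionality s; now rewrite upd_upd. }
  rewrite E in H; exact H.
Qed.

Lemma dlim_const (c : coord) (a : R) : dlim c (fun _ => a) (fun _ => 0).
Proof. intros p; apply derivable_pt_lim_const. Qed.

Lemma dlim_plus (c : coord) (F F' G G' : jet -> R) :
  dlim c F F' -> dlim c G G' ->
  dlim c (fun p => F p + G p) (fun p => F' p + G' p).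
Proof. intros H1 H2 p; exact (derivable_pt_lim_plus _ _ _ _ _ (H1 p) (H2 p)). Qed.

Lemma dlim_mult (c : coord) (F F' G G' : jet -> R) :
  dlim c F F' -> dlim c G G' ->
  dlim c (fun p => F p * G p) (fun p => F' p * G p + F p * G' p).
Proof.
  intros H1 H2 p.
  pose proof (derivable_pt_lim_mult _ _ _ _ _ (H1 p) (H2 p)) as H.
  cbv beta in H; rewrite upd_id in H; exact H.
Qed.

Lemma dlim_scal (c : coord) (a : R) (F F' : jet -> R) :
  dlim c F F' -> dlim c (fun p => a * F p) (fun p => a * F' p).
Proof. intros H p; exact (derivable_pt_lim_scal _ a _ _ (H p)). Qed.

Lemma dlim_coord (c d : coord) :
  dlim c (fun p => coord_val p d) (fun _ => if coord_dec d c then 1 else 0).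
Proof.
  intros p; destruct (coord_dec d c) as [->|ne].
  - replace (fun t => coord_val (upd p c t) c) with (fun t : R => t).
    + apply derivable_pt_lim_id.
    + extensionality t; now rewrite coord_val_upd_eq.
  - replace (fun t => coord_val (upd p c t) d) with (fun _ : R => coord_val p d).
    + apply derivable_pt_lim_const.
    + extensionality t; now rewrite coord_val_upd_neq.
Qed.

Lemma dlim_sumR {A : Type} (c : coord) (l : list A) (F F' : A -> jet -> R) :
  (forall a, In a l -> dlim c (F a) (F' a)) ->
  dlim c (fun p => sumR l (fun a => F a p)) (fun p => sumR l (fun a => F' a p)).
Proof.
  induction l as [|a l IH]; intros H; simpl.
  - apply dlim_const.
  - apply dlim_plus; [apply H; now left | apply IH; intros; apply H; now right].
Qed.

(** * Smooth functions *)

Definition close (n k : nat) (delta : R) (p q : jet) : Prop :=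
  forall c, admissible n k c -> Rabs (coord_val q c - coord_val p c) < delta.

Lemma jet_cont_close (n k : nat) (G : jet -> R) :
  jet_cont n k G <->
  forall p eps, eps > 0 -> exists delta, delta > 0 /\
    forall q, close n k delta p q -> Rabs (G q - G p) < eps.
Proof.
  split; intros H p eps He; destruct (H p eps He) as [d [Hd H']];
    exists d; split; auto; intros q.
  - intros Hq; apply H'; [intros i Hi; apply (Hq (X i) Hi) | intros K HK; apply (Hq (W K) HK)].
  - intros Hx Hw; apply H'; intros [i|K] Hc; [apply (Hx i Hc) | apply (Hw K Hc)].
Qed.

Lemma order_le_coord (n k : nat) (G : jet -> R) :
  order_le n k G <->
  forall p q, (forall c, admissible n k c -> coord_val p c = coord_val q c) -> G p = G q.
Proof.
  split; intros H p q.
  - intros Hq; apply H; [intros i Hi; apply (Hq (X i) Hi) | intros K HK; apply (Hq (W K) HK)].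
  - intros Hx Hw; apply H; intros [i|K] Hc; [apply (Hx i Hc) | apply (Hw K Hc)].
Qed.

Lemma order_le_upd (n k : nat) (F : jet -> R) (c : coord) (p : jet) (t : R) :
  order_le n k F -> ~ admissible n k c -> F (upd p c t) = F p.
Proof.
  intros H Hc; apply (proj1 (order_le_coord n k F) H); intros d Hd.
  apply coord_val_upd_neq; congruence.
Qed.

Lemma dlim_inadm (n k : nat) (F : jet -> R) (c : coord) :
  order_le n k F -> ~ admissible n k c -> dlim c F (fun _ => 0).
Proof.
  intros H Hc p.
  replace (fun t => F (upd p c t)) with (fun _ : R => F p).
  - apply derivable_pt_lim_const.
  - extensionality t; symmetry; now apply order_le_upd with n k.
Qed.

Lemma order_le_pd (n k : nat) (c : coord) (F : jet -> R) :
  order_le n k F -> order_le n k (pd c F).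
Proof.
  intros H; destruct (classic (admissible n k c)) as [Hc|Hc].
  - rewrite order_le_coord in *; intros p q Hpq; unfold pd.
    rewrite (Hpq c Hc); f_equal; extensionality t; apply H.
    intros d Hd; rewrite !coord_val_upd; destruct (coord_dec d c); auto.
  (* Here [p] and [q] may differ in the coordinate [c] itself, so the two derivatives are taken at
     different points; both vanish. *)
  - rewrite (dlim_pd c F _ (dlim_inadm n k F c H Hc)); intros p q _ _; reflexivity.
Qed.

Lemma smooth_order (n k : nat) (F : jet -> R) : smooth n k F -> order_le n k F.
Proof. now intros []. Qed.

Lemma smooth_cont (n k : nat) (F : jet -> R) : smooth n k F -> jet_cont n k F.
Proof. intros [_ H]; apply (H [] (Forall_nil _)). Qed.

Lemma smooth_dlim (n k : nat) (c : coord) (F : jet -> R) :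
  smooth n k F -> dlim c F (pd c F).
Proof.
  intros [Ho H]; apply dlim_pd_ex; intros p.
  destruct (classic (admissible n k c)) as [Hc|Hc].
  - exact (proj2 (H [] (Forall_nil _)) c Hc p).
  - exists 0; exact (dlim_inadm n k F c Ho Hc p).
Qed.

Lemma smooth_pd_adm (n k : nat) (c : coord) (F : jet -> R) :
  admissible n k c -> smooth n k F -> smooth n k (pd c F).
Proof.
  intros Hc [Ho H]; split; [now apply order_le_pd|].
  intros cs Hcs.
  replace (iter_pd cs (pd c F)) with (iter_pd (cs ++ [c]) F)
    by (unfold iter_pd; now rewrite fold_right_app).
  apply H, Forall_app; split; auto.
Qed.

(* Smoothness is the greatest predicate stable under admissible partial derivatives. *)
Lemma smooth_coind (n k : nat) (P : (jet -> R) -> Prop) :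
  (forall F, P F -> order_le n k F /\ jet_cont n k F /\
     forall c, admissible n k c -> exists G, dlim c F G /\ P G) ->
  forall F, P F -> smooth n k F.
Proof.
  intros HP F HF; split; [apply (HP F HF)|].
  intros cs Hcs.
  assert (H : P (iter_pd cs F)).
  { induction Hcs as [|c cs Hc Hcs IH]; auto; simpl.
    destruct (HP _ IH) as (_ & _ & H); destruct (H c Hc) as (G & HG & PG).
    now rewrite (dlim_pd c _ G HG). }
  destruct (HP _ H) as (_ & Hcont & Hd); split; auto.
  intros c Hc p; destruct (Hd c Hc) as (G & HG & _); exists (G p); apply HG.
Qed.

Lemma mindices_mono (n k k' : nat) (K : list nat) :
  (k <= k')%nat -> In K (mindices n k) -> In K (mindices n k').
Proof.
  unfold mindices; rewrite !in_flat_map; intros Hk (j & Hj & HK).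
  exists j; split; auto; rewrite in_seq in *; lia.
Qed.

(** The product rule turns one product into a sum of two, so products alone are not stable under
    differentiation; sums, products and constants together are, which is what [smooth_coind] asks
    for. Allowing any order [j <= k] at the leaves also yields [smooth_mono]. *)
Inductive generated (n k : nat) : (jet -> R) -> Prop :=
| gen_smooth j F : (j <= k)%nat -> smooth n j F -> generated n k F
| gen_const a : generated n k (fun _ => a)
| gen_coord c : admissible n k c -> generated n k (fun p => coord_val p c)
| gen_plus F G : generated n k F -> generated n k G -> generated n k (fun p => F p + G p)
| gen_mult F G : generated n k F -> generated n k G -> generated n k (fun p => F p * G p).

Lemma jet_cont_plus (n k : nat) (F G : jet -> R) :
  jet_cont n k F -> jet_cont n k G -> jet_cont n k (fun p => F p + G p).
Proof.
  rewrite !jet_cont_close; intros HF HG p eps He.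
  destruct (HF p (eps / 2) ltac:(lra)) as (d1 & Hd1 & H1).
  destruct (HG p (eps / 2) ltac:(lra)) as (d2 & Hd2 & H2).
  exists (Rmin d1 d2); split; [now apply Rmin_pos|].
  intros q Hq.
  specialize (H1 q (fun c Hc => Rlt_le_trans _ _ _ (Hq c Hc) (Rmin_l _ _))).
  specialize (H2 q (fun c Hc => Rlt_le_trans _ _ _ (Hq c Hc) (Rmin_r _ _))).
  replace (F q + G q - (F p + G p)) with ((F q - F p) + (G q - G p)) by ring.
  eapply Rle_lt_trans; [apply Rabs_triang|]; lra.
Qed.

Lemma jet_cont_mult (n k : nat) (F G : jet -> R) :
  jet_cont n k F -> jet_cont n k G -> jet_cont n k (fun p => F p * G p).
Proof.
  rewrite !jet_cont_close; intros HF HG p eps He.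
  (* If both increments are below e = min(1, eps / (2 B)), the product of the increments is at most
     e and the total change at most e * B <= eps / 2; the factor 2 keeps the final inequality
     strict. *)
  set (B := Rabs (F p) + Rabs (G p) + 1).
  assert (HB : B > 0) by (pose proof (Rabs_pos (F p)); pose proof (Rabs_pos (G p)); unfold B; lra).
  assert (Hm : Rmin 1 (eps / (2 * B)) > 0) by (apply Rmin_pos; [lra|apply Rdiv_lt_0_compat; lra]).
  destruct (HF p _ Hm) as (d1 & Hd1 & H1).
  destruct (HG p _ Hm) as (d2 & Hd2 & H2).
  exists (Rmin d1 d2); split; [now apply Rmin_pos|].
  intros q Hq.
  specialize (H1 q (fun c Hc => Rlt_le_trans _ _ _ (Hq c Hc) (Rmin_l _ _))).
  specialize (H2 q (fun c Hc => Rlt_le_trans _ _ _ (Hq c Hc) (Rmin_r _ _))).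
  pose proof (Rmin_l 1 (eps / (2 * B))); pose proof (Rmin_r 1 (eps / (2 * B))).
  set (e := Rmin 1 (eps / (2 * B))) in *.
  assert (HeB : e * (2 * B) <= eps).
  { apply Rle_trans with (eps / (2 * B) * (2 * B)); [apply Rmult_le_compat_r; lra|].
    right; field; lra. }
  replace (F q * G q - F p * G p)
    with ((F q - F p) * (G q - G p) + ((F q - F p) * G p + F p * (G q - G p))) by ring.
  pose proof (Rabs_triang ((F q - F p) * (G q - G p)) ((F q - F p) * G p + F p * (G q - G p))).
  pose proof (Rabs_triang ((F q - F p) * G p) (F p * (G q - G p))).
  rewrite !Rabs_mult in *.
  pose proof (Rabs_pos (F q - F p)); pose proof (Rabs_pos (G q - G p)).
  pose proof (Rabs_pos (F p)); pose proof (Rabs_pos (G p)).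
  assert (Rabs (F q - F p) * Rabs (G q - G p) <= e * 1) by (apply Rmult_le_compat; lra).
  assert (Rabs (F q - F p) * Rabs (G p) <= e * Rabs (G p)) by (apply Rmult_le_compat_r; lra).
  assert (Rabs (F p) * Rabs (G q - G p) <= Rabs (F p) * e) by (apply Rmult_le_compat_l; lra).
  assert (e * B = e * Rabs (F p) + e * Rabs (G p) + e) by (unfold B; ring).
  nra.
Qed.

Lemma generated_smooth (n k : nat) (F : jet -> R) : generated n k F -> smooth n k F.
Proof.
  apply smooth_coind; clear F; intros F HF.
  induction HF as [j F Hj HF|a|c Hc|F G HF IHF HG IHG|F G HF IHF HG IHG].
  - split; [|split].
    + intros p q Hx Hw; apply HF; auto; intros K HK; apply Hw; now apply mindices_mono with j.
    + intros p eps He; destruct (smooth_cont n j F HF p eps He) as (d & Hd & H).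
      exists d; split; auto; intros q Hx Hw; apply H; auto.
      intros K HK; apply Hw; now apply mindices_mono with j.
    + intros c Hc; destruct (classic (admissible n j c)) as [Hc'|Hc'].
      * exists (pd c F); split; [now apply smooth_dlim with n j|].
        apply gen_smooth with j; auto; now apply smooth_pd_adm.
      * exists (fun _ => 0); split; [|apply gen_const].
        apply dlim_inadm with n j; auto; apply HF.
  - split; [|split].
    + intros p q _ _; reflexivity.
    + intros p eps He; exists 1; split; [lra|]; intros q _ _.
      now rewrite Rminus_diag, Rabs_R0.
    + intros c _; exists (fun _ => 0); split; [apply dlim_const|apply gen_const].
  - split; [|split].
    + apply order_le_coord; intros p q H; now apply H.
    + apply jet_cont_close; intros p eps He; exists eps; split; auto.
    + intros d _; eexists; split; [apply dlim_coord|apply gen_const].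
  - destruct IHF as (oF & cF & dF), IHG as (oG & cG & dG); split; [|split].
    + intros p q Hx Hw; f_equal; auto.
    + now apply jet_cont_plus.
    + intros c Hc; destruct (dF c Hc) as (F' & ? & ?), (dG c Hc) as (G' & ? & ?).
      eexists; split; [apply dlim_plus; eassumption|]; now apply gen_plus.
  - destruct IHF as (oF & cF & dF), IHG as (oG & cG & dG); split; [|split].
    + intros p q Hx Hw; f_equal; auto.
    + now apply jet_cont_mult.
    + intros c Hc; destruct (dF c Hc) as (F' & ? & ?), (dG c Hc) as (G' & ? & ?).
      eexists; split; [apply dlim_mult; eassumption|].
      apply gen_plus; now apply gen_mult.
Qed.

Lemma smooth_mono (n j k : nat) (F : jet -> R) : (j <= k)%nat -> smooth n j F -> smooth n k F.
Proof. intros; apply generated_smooth; now apply gen_smooth with j. Qed.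

Lemma smooth_const (n k : nat) (a : R) : smooth n k (fun _ => a).
Proof. apply generated_smooth, gen_const. Qed.

Lemma smooth_coord (n k : nat) (c : coord) :
  admissible n k c -> smooth n k (fun p => coord_val p c).
Proof. intros; now apply generated_smooth, gen_coord. Qed.

Lemma smooth_plus (n k : nat) (F G : jet -> R) :
  smooth n k F -> smooth n k G -> smooth n k (fun p => F p + G p).
Proof. intros; apply generated_smooth, gen_plus; now apply gen_smooth with k. Qed.

Lemma smooth_mult (n k : nat) (F G : jet -> R) :
  smooth n k F -> smooth n k G -> smooth n k (fun p => F p * G p).
Proof. intros; apply generated_smooth, gen_mult; now apply gen_smooth with k. Qed.

Lemma smooth_scal (n k : nat) (a : R) (F : jet -> R) :
  smooth n k F -> smooth n k (fun p => a * F p).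
Proof. intros; apply smooth_mult; auto using smooth_const. Qed.

Lemma smooth_sumR {A : Type} (n k : nat) (l : list A) (F : A -> jet -> R) :
  (forall a, In a l -> smooth n k (F a)) -> smooth n k (fun p => sumR l (fun a => F a p)).
Proof.
  induction l as [|a l IH]; intros H; simpl.
  - apply smooth_const.
  - apply smooth_plus; [apply H; now left | apply IH; intros; apply H; now right].
Qed.

Lemma pd_inadm (n k : nat) (F : jet -> R) (c : coord) :
  smooth n k F -> ~ admissible n k c -> pd c F = fun _ => 0.
Proof. intros HF Hc; apply dlim_pd, dlim_inadm with n k; auto; apply HF. Qed.

Lemma smooth_pd (n k : nat) (c : coord) (F : jet -> R) :
  smooth n k F -> smooth n k (pd c F).
Proof.
  intros HF; destruct (classic (admissible n k c)) as [Hc|Hc].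
  - now apply smooth_pd_adm.
  - rewrite (pd_inadm n k F c HF Hc); apply smooth_const.
Qed.

Lemma jet_cont_continuity_2d (n k : nat) (G : jet -> R) (p : jet) (c d : coord) (x y : R) :
  jet_cont n k G -> continuity_2d_pt (fun u v => G (upd (upd p c u) d v)) x y.
Proof.
  rewrite jet_cont_close; intros H eps.
  destruct (H (upd (upd p c x) d y) eps (cond_pos eps)) as (delta & Hd & H').
  exists (mkposreal delta Hd); simpl; intros u v Hu Hv; apply H'.
  intros e _; rewrite !coord_val_upd.
  destruct (coord_dec e d); auto; destruct (coord_dec e c); auto.
  now rewrite Rminus_diag, Rabs_R0.
Qed.

(** Schwarz's theorem for the two-parameter family obtained by overwriting [c] and [d]. The case
    [c = d] is split off because the second overwriting would erase the first. *)
Lemma pd_comm (n k : nat) (c d : coord) (F : jet -> R) :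
  smooth n k F -> pd c (pd d F) = pd d (pd c F).
Proof.
  intros HF; destruct (coord_dec c d) as [->|ne]; auto.
  extensionality p.
  assert (Dc : forall (H : jet -> R) u v, smooth n k H ->
    is_derive (fun z => H (upd (upd p c z) d v)) u (pd c H (upd (upd p c u) d v))).
  { intros H u v HH.
    apply is_derive_ext with (fun z => H (upd (upd p d v) c z)).
    - intros z; now rewrite upd_comm.
    - rewrite upd_comm by auto; apply dlim_at; now apply smooth_dlim with n k. }
  assert (Dd : forall (H : jet -> R) u v, smooth n k H ->
    is_derive (fun z => H (upd (upd p c u) d z)) v (pd d H (upd (upd p c u) d v))).
  { intros H u v HH; apply dlim_at; now apply smooth_dlim with n k. }
  assert (E1 : forall u, (fun z => Derive (fun t => F (upd (upd p c z) d t)) u)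
                = (fun z => pd d F (upd (upd p c z) d u))).
  { intros u; extensionality z; apply is_derive_unique, Dd, HF. }
  assert (E2 : forall u, (fun z => Derive (fun t => F (upd (upd p c t) d z)) u)
                = (fun z => pd c F (upd (upd p c u) d z))).
  { intros u; extensionality z; apply is_derive_unique, Dc, HF. }
  assert (E3 : forall u v, Derive (fun z => Derive (fun t => F (upd (upd p c z) d t)) v) u
                = pd c (pd d F) (upd (upd p c u) d v)).
  { intros u v; rewrite E1; apply is_derive_unique, Dc; now apply smooth_pd. }
  assert (E4 : forall u v, Derive (fun z => Derive (fun t => F (upd (upd p c t) d z)) u) v
                = pd d (pd c F) (upd (upd p c u) d v)).
  { intros u v; rewrite E2; apply is_derive_unique, Dd; now apply smooth_pd. }
  pose proof (Schwarz (fun u v => F (upd (upd p c u) d v)) (coord_val p c) (coord_val p d)) as S.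
  cbv beta in S; rewrite E3, E4, !upd_id in S; apply S.
  - exists (mkposreal 1 Rlt_0_1); intros u v _ _; rewrite E1, E2.
    pose proof (smooth_pd n k c F HF); pose proof (smooth_pd n k d F HF).
    repeat split; eexists; eauto.
  - apply continuity_2d_pt_ext with (fun u v => pd c (pd d F) (upd (upd p c u) d v)).
    + intros; now rewrite E3.
    + apply jet_cont_continuity_2d with n k, smooth_cont; now apply smooth_pd, smooth_pd.
  - apply continuity_2d_pt_ext with (fun u v => pd d (pd c F) (upd (upd p c u) d v)).
    + intros; now rewrite E4.
    + apply jet_cont_continuity_2d with n k, smooth_cont; now apply smooth_pd, smooth_pd.
Qed.

(** * Integration along a coordinate *)

(** The base point 0 is the same on every line in direction [c], so differentiating in another
    coordinate produces no boundary term. Integration from 0 is where data on the whole space is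
    used. *)
Definition prim (c : coord) (F : jet -> R) (p : jet) : R :=
  RInt (fun s => F (upd p c s)) 0 (coord_val p c).

Lemma jet_cont_line (n k : nat) (F : jet -> R) (c : coord) (p : jet) (s : R) :
  jet_cont n k F -> continuous (fun s => F (upd p c s)) s.
Proof.
  rewrite jet_cont_close; intros H.
  apply continuity_pt_filterlim; intros eps He.
  destruct (H (upd p c s) eps He) as (d & Hd & H'); exists d; split; auto.
  intros t [_ Ht]; apply H'; intros e _; rewrite !coord_val_upd.
  destruct (coord_dec e c); auto; now rewrite Rminus_diag, Rabs_R0.
Qed.

Lemma ex_RInt_line (n k : nat) (F : jet -> R) (c : coord) (p : jet) (a b : R) :
  jet_cont n k F -> ex_RInt (fun s => F (upd p c s)) a b.
Proof. intros H; apply @ex_RInt_continuous; intros s _; now apply jet_cont_line with n k. Qed.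

Lemma dlim_prim_same (n k : nat) (c : coord) (F : jet -> R) :
  jet_cont n k F -> dlim c (prim c F) F.
Proof.
  intros HF p; apply is_derive_Reals; unfold prim.
  apply is_derive_ext with (fun t => RInt (fun s => F (upd p c s)) 0 t).
  - intros t; rewrite coord_val_upd_eq; apply RInt_ext; intros s _; now rewrite upd_upd.
  - replace (F p) with (F (upd p c (coord_val p c))) by now rewrite upd_id.
    apply (is_derive_RInt (fun s => F (upd p c s)) _ 0); [|now apply jet_cont_line with n k].
    exists (mkposreal 1 Rlt_0_1); intros t _.
    apply @RInt_correct; now apply ex_RInt_line with n k.
Qed.

Lemma dlim_prim_other (n k : nat) (c d : coord) (F : jet -> R) :
  c <> d -> smooth n k F -> dlim d (prim c F) (prim c (pd d F)).
Proof.
  intros ne HF p; apply is_derive_Reals; unfold prim.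
  assert (E : forall t u, Derive (fun z => F (upd (upd p d z) c t)) u
                          = pd d F (upd (upd p d u) c t)).
  { intros t u; apply is_derive_unique.
    apply is_derive_ext with (fun z => F (upd (upd p c t) d z)).
    - intros z; now rewrite upd_comm.
    - rewrite <- upd_comm by auto; apply dlim_at; now apply smooth_dlim with n k. }
  apply is_derive_ext
    with (fun t => RInt (fun s => F (upd (upd p d t) c s)) 0 (coord_val p c)).
  { intros t; now rewrite coord_val_upd_neq. }
  replace (RInt (fun s => pd d F (upd p c s)) 0 (coord_val p c))
    with (RInt (fun t => Derive (fun z => F (upd (upd p d z) c t)) (coord_val p d))
            0 (coord_val p c)).
  2:{ apply RInt_ext; intros t _; now rewrite E, upd_id. }
  apply (is_derive_RInt_param (fun u t => F (upd (upd p d u) c t))).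
  - exists (mkposreal 1 Rlt_0_1); intros u _ t _.
    eexists; apply is_derive_ext with (fun z => F (upd (upd p c t) d z)).
    + intros z; now rewrite upd_comm.
    + apply dlim_at; now apply smooth_dlim with n k.
  - intros t _; apply continuity_2d_pt_ext with (fun u v => pd d F (upd (upd p d u) c v)).
    + intros; now rewrite E.
    + apply jet_cont_continuity_2d with n k, smooth_cont; now apply smooth_pd.
  - exists (mkposreal 1 Rlt_0_1); intros u _; apply ex_RInt_line with n k; now apply smooth_cont.
Qed.

(** Continuity on the jet space is pointwise; compactness of the segment from [a] to [b] makes the
    radius uniform along it, as in the tube lemma. *)
Lemma jet_cont_uniform_line (n k : nat) (F : jet -> R) (c : coord) (p : jet) (a b eps : R) :
  jet_cont n k F -> eps > 0 ->
  exists delta, delta > 0 /\ forall q, close n k delta p q ->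
    forall s, a <= s <= b -> Rabs (F (upd q c s) - F (upd p c s)) < eps.
Proof.
  rewrite jet_cont_close; intros HF He.
  assert (H : forall s, exists d : posreal, forall q,
             close n k d (upd p c s) q -> Rabs (F q - F (upd p c s)) < eps / 2).
  { intros s; destruct (HF (upd p c s) (eps / 2) ltac:(lra)) as (d & Hd & H).
    now exists (mkposreal d Hd). }
  set (del s := proj1_sig (constructive_indefinite_description _ (H s))).
  assert (Hdel : forall s q, close n k (del s) (upd p c s) q ->
                  Rabs (F q - F (upd p c s)) < eps / 2).
  { intros s; exact (proj2_sig (constructive_indefinite_description _ (H s))). }
  destruct (compactness_value_1d a b del) as [d Hd].
  exists d; split; [apply cond_pos|].
  intros q Hq s Hs.
  destruct (NNPP _ (Hd s Hs)) as (t & _ & Ht & Hdt).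
  (* Both [upd q c s] and [upd p c s] lie in the gauge neighbourhood of [upd p c t]: the coordinate
     [c] is controlled by the distance from s to t, all others by [d <= del t]. Each comparison
     costs [eps / 2]. *)
  assert (Hc : forall r, close n k d p r -> close n k (del t) (upd p c t) (upd r c s)).
  { intros r Hr e Hadm; rewrite !coord_val_upd; destruct (coord_dec e c); auto.
    eapply Rlt_le_trans; [apply Hr|]; auto. }
  assert (Hp : close n k d p p).
  { intros e _; rewrite Rminus_diag, Rabs_R0; apply cond_pos. }
  pose proof (Hdel t _ (Hc q Hq)); pose proof (Hdel t _ (Hc p Hp)).
  replace (F (upd q c s) - F (upd p c s))
    with ((F (upd q c s) - F (upd p c t)) - (F (upd p c s) - F (upd p c t))) by ring.
  eapply Rle_lt_trans; [apply Rabs_triang|]; rewrite Rabs_Ropp; lra.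
Qed.

(** Integrand and upper limit both move with the point. The variation is split at [upd p c y], where
    [y] is the new upper limit: up to there only the limit moves, afterwards only the integrand. *)
Lemma jet_cont_prim (n k : nat) (c : coord) (F : jet -> R) :
  admissible n k c -> jet_cont n k F -> jet_cont n k (prim c F).
Proof.
  intros Hc HF; apply jet_cont_close; intros p eps He.
  (* A bound for the upper limit at every point whose [c] coordinate is within 1 of that of [p]; it
     bounds the length of all integration intervals that occur. *)
  set (B := Rabs (coord_val p c) + 1).
  assert (HB : B > 0) by (pose proof (Rabs_pos (coord_val p c)); unfold B; lra).
  destruct (jet_cont_uniform_line n k F c p (- B) B (eps / (2 * B)) HF)
    as (d1 & Hd1 & H1); [apply Rdiv_lt_0_compat; lra|].
  assert (Hcont : continuity_pt (fun t => prim c F (upd p c t)) (coord_val p c)).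
  { apply derivable_continuous_pt; exists (F p).
    apply (dlim_prim_same n k c F HF p). }
  destruct (Hcont (eps / 2) ltac:(lra)) as (d2 & Hd2 & H2).
  exists (Rmin 1 (Rmin d1 d2)); split; [repeat apply Rmin_pos; lra|].
  intros q Hq.
  assert (Hq1 : close n k d1 p q).
  { intros e Hadm; eapply Rlt_le_trans; [now apply Hq|].
    eapply Rle_trans; [apply Rmin_r | apply Rmin_l]. }
  pose proof (Hq c Hc) as Hqc.
  set (y := coord_val q c) in *.
  assert (Hy2 : Rabs (prim c F (upd p c y) - prim c F p) < eps / 2).
  { destruct (Req_dec y (coord_val p c)) as [->|ney].
    - rewrite upd_id, Rminus_diag, Rabs_R0; lra.
    - specialize (H2 y); simpl in H2; unfold Rdist in H2; rewrite upd_id in H2.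
      apply H2; split; [split; [exact I | congruence] |].
      eapply Rlt_le_trans; [exact Hqc|].
      eapply Rle_trans; [apply Rmin_r | apply Rmin_r]. }
  assert (Hy : Rabs y <= B).
  { pose proof (Rmin_l 1 (Rmin d1 d2)); unfold B.
    replace y with ((y - coord_val p c) + coord_val p c) by ring.
    eapply Rle_trans; [apply Rabs_triang|]; lra. }
  assert (Hy1 : Rabs (prim c F q - prim c F (upd p c y)) <= eps / 2).
  { unfold prim; rewrite coord_val_upd_eq; fold y.
    rewrite (RInt_ext (fun s => F (upd (upd p c y) c s)) (fun s => F (upd p c s)))
      by (intros; now rewrite upd_upd).
    change (Rabs (minus (RInt (fun s => F (upd q c s)) 0 y)
                        (RInt (fun s => F (upd p c s)) 0 y)) <= eps / 2).
    rewrite <- (@RInt_minus R_CompleteNormedModule) by now apply ex_RInt_line with n k.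
    apply Rle_trans with (Rabs y * (eps / (2 * B))).
    2:{ apply Rle_trans with (B * (eps / (2 * B))).
        - apply Rmult_le_compat_r; auto; left; apply Rdiv_lt_0_compat; lra.
        - right; field; lra. }
    assert (Hex : forall a b, ex_RInt (fun s => minus (F (upd q c s)) (F (upd p c s))) a b).
    { intros; apply @ex_RInt_minus; now apply ex_RInt_line with n k. }
    assert (Hb : forall s, - B <= s <= B ->
              Rabs (minus (F (upd q c s)) (F (upd p c s))) <= eps / (2 * B)).
    { intros s Hs; left; exact (H1 q Hq1 s Hs). }
    apply Rabs_le_between in Hy.
    destruct (Rle_dec 0 y) as [Hpos|Hneg].
    - rewrite (Rabs_pos_eq y) by auto; rewrite <- (Rminus_0_r y) at 2.
      apply abs_RInt_le_const; auto; intros s Hs; apply Hb; lra.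
    - rewrite <- opp_RInt_swap by apply Hex.
      rewrite (Rabs_left y) by lra; replace (- y) with (0 - y) by ring.
      change (Rabs (- RInt (fun s => minus (F (upd q c s)) (F (upd p c s))) y 0)
              <= (0 - y) * (eps / (2 * B))).
      rewrite Rabs_Ropp.
      apply abs_RInt_le_const; auto; [lra|]; intros s Hs; apply Hb; lra. }
  replace (prim c F q - prim c F p)
    with ((prim c F q - prim c F (upd p c y)) + (prim c F (upd p c y) - prim c F p)) by ring.
  eapply Rle_lt_trans; [apply Rabs_triang|]; lra.
Qed.

(** A derivative of a primitive along [c] is the integrand itself or, in another direction, again a
    primitive along [c]. So the functions that are smooth or primitives of smooth ones form a class
    closed under differentiation. *)
Lemma smooth_prim (n k : nat) (c : coord) (F : jet -> R) :
  admissible n k c -> smooth n k F -> smooth n k (prim c F).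
Proof.
  intros Hc HF.
  apply (smooth_coind n k (fun G => smooth n k G \/ exists H, smooth n k H /\ G = prim c H)).
  2:{ right; now exists F. }
  clear F HF; intros G [HG|(F & HF & ->)].
  - split; [apply HG|split; [now apply smooth_cont|]].
    intros d _; exists (pd d G); split; [now apply smooth_dlim with n k|].
    left; now apply smooth_pd.
  - split; [|split].
    + apply order_le_coord; intros p q Hpq; unfold prim; rewrite (Hpq c Hc).
      apply RInt_ext; intros s _; apply (proj1 (order_le_coord n k F) (smooth_order n k F HF)).
      intros e He; rewrite !coord_val_upd; destruct (coord_dec e c); auto.
    + apply jet_cont_prim; auto; now apply smooth_cont.
    + intros d _; destruct (coord_dec c d) as [<-|ne].
      * exists F; split; auto; apply dlim_prim_same with n k; now apply smooth_cont.
      * exists (prim c (pd d F)); split; [now apply dlim_prim_other with n k|].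
        right; exists (pd d F); split; auto; now apply smooth_pd.
Qed.

Lemma prim_zero (c : coord) : prim c (fun _ => 0) = fun _ => 0.
Proof.
  extensionality p; unfold prim; rewrite RInt_const.
  unfold scal; simpl; unfold mult; simpl; ring.
Qed.

Lemma pd_prim_zero (n k : nat) (c d : coord) (F : jet -> R) :
  smooth n k F -> d <> c -> pd d F = (fun _ => 0) -> pd d (prim c F) = fun _ => 0.
Proof.
  intros HF ne HdF.
  rewrite (dlim_pd d _ _ (dlim_prim_other n k c d F (not_eq_sym ne) HF)), HdF.
  apply prim_zero.
Qed.

(* Successive integration along the coordinates of [L]: subtracting from each
   [v d] the derivative of the primitive in the first coordinate [c] leaves a
   closed family that no longer depends on [c]. *)
Lemma closed_family_exact (n k : nat) (L : list coord) :
  NoDup L -> (forall c, In c L -> admissible n k c) ->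
  forall v : coord -> jet -> R,
  (forall c, In c L -> smooth n k (v c)) ->
  (forall c d, In c L -> In d L -> pd c (v d) = pd d (v c)) ->
  exists g, smooth n k g /\ (forall c, In c L -> pd c g = v c) /\
    (forall e, ~ In e L -> (forall c, In c L -> pd e (v c) = fun _ => 0) ->
       pd e g = fun _ => 0).
Proof.
  induction L as [|c L IH]; intros HL Hadm v Hv Hclosed.
  - exists (fun _ => 0); split; [apply smooth_const|split].
    + intros c [].
    + intros e _ _; apply dlim_pd, dlim_const.
  - apply NoDup_cons_iff in HL; destruct HL as [HcL HL].
    assert (Hc : smooth n k (v c)) by (apply Hv; now left).
    assert (Hac : admissible n k c) by (apply Hadm; now left).
    pose proof (smooth_prim n k c (v c) Hac Hc) as Ha.
    set (a := prim c (v c)) in *.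
    assert (Hca : pd c a = v c)
      by (apply dlim_pd, dlim_prim_same with n k; now apply smooth_cont).
    set (v' := fun d p => v d p + (-1) * pd d a p).
    assert (Ev' : forall e d, In d L ->
              pd e (v' d) = fun p => pd e (v d) p + (-1) * pd e (pd d a) p).
    { intros e d Hd; apply dlim_pd, dlim_plus; [|apply dlim_scal];
        apply smooth_dlim with n k; [apply Hv; now right | now apply smooth_pd]. }
    destruct (IH HL) with (v := v') as (g & Hg & Hgv & Hg0).
    + intros d Hd; apply Hadm; now right.
    + intros d Hd; apply smooth_plus; [apply Hv; now right|].
      now apply smooth_scal, smooth_pd.
    + intros d e Hd He; rewrite !Ev' by auto; extensionality p.
      rewrite (Hclosed d e) by (now right); now rewrite (pd_comm n k d e a).
    (* The last conjunct of the induction hypothesis serves here: the corrected family [v'] does not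
       depend on [c], hence neither does its potential [g], and adding [g] leaves the derivative of
       [a] along [c] intact. *)
    + assert (Hcg : pd c g = fun _ => 0).
      { apply Hg0; auto; intros d Hd; rewrite Ev' by auto; extensionality p.
        rewrite (pd_comm n k c d a Ha), Hca, (Hclosed c d); [ring|now left|now right]. }
      assert (Esum : forall e, pd e (fun p => a p + g p) = fun p => pd e a p + pd e g p).
      { intros e; apply dlim_pd, dlim_plus; now apply smooth_dlim with n k. }
      exists (fun p => a p + g p); split; [now apply smooth_plus|split].
      * intros d [<-|Hd]; rewrite Esum; extensionality p.
        -- rewrite Hca, Hcg; ring.
        -- rewrite (Hgv d Hd); unfold v'; ring.
      * intros e He He0; rewrite Esum; extensionality p.
        assert (Hea : pd e a = fun _ => 0).
        { apply pd_prim_zero with n k; auto.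
          - intros ->; apply He; now left.
          - apply He0; now left. }
        rewrite Hea, Hg0; [ring| |].
        -- intros H; apply He; now right.
        -- intros d Hd; rewrite Ev', He0, (pd_comm n k e d a Ha), Hea by (auto; now right).
           rewrite (dlim_pd d _ _ (dlim_const d 0)); extensionality q; ring.
Qed.

(** * Finite sums and multi-indices *)

Lemma sumR_ext {A : Type} (l : list A) (f g : A -> R) :
  (forall a, In a l -> f a = g a) -> sumR l f = sumR l g.
Proof.
  induction l as [|a l IH]; simpl; auto; intros H.
  rewrite (H a), IH; auto.
Qed.

Lemma sumR_plus {A : Type} (l : list A) (f g : A -> R) :
  sumR l (fun a => f a + g a) = sumR l f + sumR l g.
Proof. induction l as [|a l IH]; simpl; [|rewrite IH]; ring. Qed.

Lemma sumR_scal {A : Type} (l : list A) (x : R) (f : A -> R) :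
  sumR l (fun a => x * f a) = x * sumR l f.
Proof. induction l as [|a l IH]; simpl; [|rewrite IH]; ring. Qed.

Lemma sumR_zero {A : Type} (l : list A) (f : A -> R) :
  (forall a, In a l -> f a = 0) -> sumR l f = 0.
Proof.
  induction l as [|a l IH]; simpl; auto; intros H.
  rewrite (H a), IH; auto; ring.
Qed.

Lemma sumR_app {A : Type} (l l' : list A) (f : A -> R) :
  sumR (l ++ l') f = sumR l f + sumR l' f.
Proof. induction l as [|a l IH]; simpl; [|rewrite IH]; ring. Qed.

Lemma sumR_map {A B : Type} (h : A -> B) (l : list A) (f : B -> R) :
  sumR (map h l) f = sumR l (fun a => f (h a)).
Proof. induction l as [|a l IH]; simpl; [|rewrite IH]; ring. Qed.

Lemma sumR_swap {A B : Type} (l : list A) (l' : list B) (f : A -> B -> R) :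
  sumR l (fun a => sumR l' (fun b => f a b)) = sumR l' (fun b => sumR l (fun a => f a b)).
Proof.
  induction l as [|a l IH]; simpl.
  - symmetry; now apply sumR_zero.
  - now rewrite IH, sumR_plus.
Qed.

Lemma sumR_delta {A : Type} (dec : forall a b : A, {a = b} + {a <> b})
  (l : list A) (x : A) (f : A -> R) :
  NoDup l -> In x l -> sumR l (fun a => if dec x a then f a else 0) = f x.
Proof.
  intros Hl; induction Hl as [|a l Ha Hl IH]; [easy|]; intros Hx; simpl.
  destruct (dec x a) as [->|ne].
  - rewrite sumR_zero; [ring|].
    intros b Hb; destruct (dec a b); [congruence|auto].
  - rewrite IH; [ring|]; destruct Hx; congruence.
Qed.

Lemma NoDup_flat_map_disjoint {A B : Type} (f : A -> list B) (l : list A) :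
  NoDup l -> (forall a, In a l -> NoDup (f a)) ->
  (forall a b x, In x (f a) -> In x (f b) -> a = b) -> NoDup (flat_map f l).
Proof.
  intros Hl Hf Hd; induction Hl as [|a l Ha Hl IH]; simpl; [constructor|].
  apply NoDup_app.
  - apply Hf; now left.
  - apply IH; intros b Hb; apply Hf; now right.
  - intros x Hx Hx'; apply in_flat_map in Hx'; destruct Hx' as (b & Hb & Hxb).
    apply Ha; now rewrite (Hd a b x Hx Hxb).
Qed.

Definition valid (n : nat) (K : list nat) : Prop :=
  nondecr K = true /\ Forall (fun a => (a < n)%nat) K.

Lemma in_all_lists (n j : nat) (K : list nat) :
  In K (all_lists n j) <-> length K = j /\ Forall (fun a => (a < n)%nat) K.
Proof.
  revert K; induction j as [|j IH]; intros K; simpl.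
  - split.
    + intros [<-|[]]; now split.
    + intros [H _]; left; destruct K; easy.
  - rewrite in_flat_map; split.
    + intros (i & Hi & HK); apply in_map_iff in HK; destruct HK as (J & <- & HJ).
      apply IH in HJ; destruct HJ as [<- HJ]; rewrite in_seq in Hi.
      split; auto; constructor; auto; lia.
    + intros [HK HF]; destruct K as [|i K]; [easy|].
      inversion HF; subst; exists i; split; [rewrite in_seq; lia|].
      apply in_map, IH; split; auto.
Qed.

Lemma in_mindices (n k : nat) (K : list nat) :
  In K (mindices n k) <-> (length K <= k)%nat /\ valid n K.
Proof.
  unfold mindices, valid; rewrite in_flat_map; split.
  - intros (j & Hj & HK); apply filter_In in HK; rewrite in_all_lists in HK.
    rewrite in_seq in Hj; destruct HK as ((<- & HF) & HK); repeat split; auto; lia.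
  - intros (HK & Hn & HF); exists (length K); rewrite in_seq; split; [lia|].
    apply filter_In; rewrite in_all_lists; auto.
Qed.

Lemma NoDup_mindices (n k : nat) : NoDup (mindices n k).
Proof.
  assert (H : forall j, NoDup (all_lists n j)).
  { induction j as [|j IH]; simpl.
    - constructor; [easy|constructor].
    - apply NoDup_flat_map_disjoint; [apply seq_NoDup| |].
      + intros i _; apply Injective_map_NoDup; auto; intros J K E; congruence.
      + intros a b K Ha Hb; apply in_map_iff in Ha, Hb.
        destruct Ha as (? & <- & _), Hb as (? & E & _); congruence. }
  apply NoDup_flat_map_disjoint; [apply seq_NoDup| |].
  - intros j _; now apply NoDup_filter.
  - intros a b K Ha Hb; apply filter_In in Ha, Hb; rewrite in_all_lists in Ha, Hb; lia.
Qed.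

Lemma sumR_mindices_mono (n k N : nat) (g : list nat -> R) :
  (k <= N)%nat ->
  (forall M, In M (mindices n N) -> ~ In M (mindices n k) -> g M = 0) ->
  sumR (mindices n N) g = sumR (mindices n k) g.
Proof.
  intros Hk Hg.
  assert (E : mindices n N = mindices n k ++
    flat_map (fun j => filter nondecr (all_lists n j)) (seq (S k) (N - k))).
  { unfold mindices; rewrite <- flat_map_app.
    change (seq (S k) (N - k)) with (seq (0 + S k) (N - k)).
    rewrite <- seq_app; do 2 f_equal; lia. }
  rewrite E, sumR_app, (sumR_zero (flat_map _ _)); [ring|].
  intros M HM; apply Hg.
  - rewrite E; apply in_or_app; now right.
  - rewrite in_mindices; apply in_flat_map in HM; destruct HM as (j & Hj & HM).
    apply filter_In in HM; rewrite in_all_lists in HM; rewrite in_seq in Hj; lia.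
Qed.

Lemma length_insert (i : nat) (K : list nat) : length (insert i K) = S (length K).
Proof. induction K as [|a K IH]; simpl; auto; destruct (Nat.leb i a); simpl; auto. Qed.

Lemma insert_comm (i j : nat) (K : list nat) :
  insert i (insert j K) = insert j (insert i K).
Proof.
  induction K as [|a K IH]; simpl.
  - destruct (Nat.leb_spec i j), (Nat.leb_spec j i); auto; [|lia].
    now replace i with j by lia.
  - destruct (Nat.leb_spec j a), (Nat.leb_spec i a); simpl;
    destruct (Nat.leb_spec i j), (Nat.leb_spec j i); simpl;
    repeat match goal with |- context [Nat.leb ?x ?y] => destruct (Nat.leb_spec x y) end;
    try lia; try congruence; now replace i with j by lia.
Qed.

Lemma nondecr_insert (i : nat) (K : list nat) :
  nondecr K = true -> nondecr (insert i K) = true.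
Proof.
  induction K as [|a K IH]; simpl; auto; intros H.
  destruct (Nat.leb_spec i a) as [Hia|Hia].
  - apply andb_true_intro; split; [now apply Nat.leb_le|exact H].
  - destruct K as [|b K]; simpl.
    + now rewrite (proj2 (Nat.leb_le a i)) by lia.
    + apply andb_prop in H; destruct H as [H1 H2]; specialize (IH H2); simpl in IH.
      destruct (Nat.leb i b); simpl in *.
      * now rewrite (proj2 (Nat.leb_le a i)), IH by lia.
      * now rewrite H1, IH.
Qed.

Lemma valid_insert (n i : nat) (K : list nat) :
  (i < n)%nat -> valid n K -> valid n (insert i K).
Proof.
  intros Hi [H1 H2]; split; [now apply nondecr_insert|].
  clear H1; induction H2 as [|a K Ha HK IH]; simpl; auto.
  destruct (Nat.leb i a); auto.
Qed.

Lemma admissible_valid (n : nat) (K : list nat) :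
  valid n K -> admissible n (length K) (W K).
Proof. intros H; apply in_mindices; auto. Qed.

(** * Linear operators on functions of finite order *)

Definition sm (n : nat) (F : jet -> R) : Prop := exists k, smooth n k F.

Lemma sm_const (n : nat) (a : R) : sm n (fun _ => a).
Proof. exists 0%nat; apply smooth_const. Qed.

Lemma sm_common (n : nat) (F G : jet -> R) :
  sm n F -> sm n G -> exists k, smooth n k F /\ smooth n k G.
Proof.
  intros [j HF] [k HG]; exists (max j k); split;
    eapply smooth_mono; try eassumption; lia.
Qed.

Lemma sm_plus (n : nat) (F G : jet -> R) : sm n F -> sm n G -> sm n (fun p => F p + G p).
Proof.
  intros HF HG; destruct (sm_common n F G HF HG) as (k & ? & ?).
  exists k; now apply smooth_plus.
Qed.

Lemma sm_mult (n : nat) (F G : jet -> R) : sm n F -> sm n G -> sm n (fun p => F p * G p).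
Proof.
  intros HF HG; destruct (sm_common n F G HF HG) as (k & ? & ?).
  exists k; now apply smooth_mult.
Qed.

Lemma sm_pd (n : nat) (c : coord) (F : jet -> R) : sm n F -> sm n (pd c F).
Proof. intros [k H]; exists k; now apply smooth_pd. Qed.

Lemma sm_coord (n : nat) (K : list nat) : valid n K -> sm n (fun p => jw p K).
Proof.
  intros H; exists (length K); apply (smooth_coord n (length K) (W K)).
  now apply admissible_valid.
Qed.

Lemma sm_sumR {A : Type} (n : nat) (l : list A) (F : A -> jet -> R) :
  (forall a, In a l -> sm n (F a)) -> sm n (fun p => sumR l (fun a => F a p)).
Proof.
  induction l as [|a l IH]; intros H; simpl.
  - apply sm_const.
  - apply sm_plus; [apply H; now left | apply IH; intros; apply H; now right].
Qed.

Lemma sm_dlim (n : nat) (c : coord) (F : jet -> R) : sm n F -> dlim c F (pd c F).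
Proof. intros [k H]; now apply smooth_dlim with n k. Qed.

Lemma sm_pd_comm (n : nat) (c d : coord) (F : jet -> R) :
  sm n F -> pd c (pd d F) = pd d (pd c F).
Proof. intros [k H]; now apply pd_comm with n k. Qed.

Definition operator : Type := (jet -> R) -> jet -> R.

(** Linearity is confined to [sm] because [pd] is additive only where derivatives exist; stability
    of [sm] lets such operators be composed. *)
Definition linear (n : nat) (T : operator) : Prop :=
  (forall F, sm n F -> sm n (T F)) /\
  (forall F G, sm n F -> sm n G -> T (fun p => F p + G p) = fun p => T F p + T G p) /\
  (forall a F, sm n F -> T (fun p => a * F p) = fun p => a * T F p).

Lemma linear_zero (n : nat) (T : operator) : linear n T -> T (fun _ => 0) = fun _ => 0.
Proof.
  intros (_ & _ & H); specialize (H 0 _ (sm_const n 0)).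
  replace (fun _ : jet => 0) with (fun _ : jet => 0 * 0) by (extensionality p; ring).
  rewrite H; extensionality p; ring.
Qed.

Lemma linear_sumR {A : Type} (n : nat) (T : operator) (l : list A) (F : A -> jet -> R) :
  linear n T -> (forall a, In a l -> sm n (F a)) ->
  T (fun p => sumR l (fun a => F a p)) = fun p => sumR l (fun a => T (F a) p).
Proof.
  intros HT; induction l as [|a l IH]; intros HF; simpl.
  - now apply linear_zero with n.
  - rewrite (proj1 (proj2 HT)).
    + rewrite IH; auto; intros b Hb; apply HF; now right.
    + apply HF; now left.
    + apply sm_sumR; intros b Hb; apply HF; now right.
Qed.

Lemma linear_id (n : nat) : linear n (fun F => F).
Proof. repeat split; auto. Qed.

Lemma linear_null (n : nat) : linear n (fun _ _ => 0).
Proof.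
  repeat split; intros; try apply sm_const; extensionality p; ring.
Qed.

Lemma linear_comp (n : nat) (T U : operator) :
  linear n T -> linear n U -> linear n (fun F => T (U F)).
Proof.
  intros (T1 & T2 & T3) (U1 & U2 & U3); split; [|split]; intros.
  - auto.
  - rewrite U2, T2; auto.
  - rewrite U3, T3; auto.
Qed.

Lemma linear_plus (n : nat) (T U : operator) :
  linear n T -> linear n U -> linear n (fun F p => T F p + U F p).
Proof.
  intros (T1 & T2 & T3) (U1 & U2 & U3); split; [|split]; intros.
  - apply sm_plus; auto.
  - rewrite U2, T2 by auto; extensionality p; ring.
  - rewrite U3, T3 by auto; extensionality p; ring.
Qed.

Lemma linear_mult (n : nat) (G : jet -> R) (T : operator) :
  sm n G -> linear n T -> linear n (fun F p => G p * T F p).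
Proof.
  intros HG (T1 & T2 & T3); split; [|split]; intros.
  - apply sm_mult; auto.
  - rewrite T2 by auto; extensionality p; ring.
  - rewrite T3 by auto; extensionality p; ring.
Qed.

Lemma linear_scal (n : nat) (a : R) (T : operator) :
  linear n T -> linear n (fun F p => a * T F p).
Proof. apply (linear_mult n (fun _ => a)), sm_const. Qed.

Lemma linear_pd (n : nat) (c : coord) : linear n (pd c).
Proof.
  split; [|split]; intros.
  - now apply sm_pd.
  - apply dlim_pd, dlim_plus; now apply sm_dlim with n.
  - apply dlim_pd, dlim_scal; now apply sm_dlim with n.
Qed.

Lemma pd_mult (n : nat) (c : coord) (F G : jet -> R) : sm n F -> sm n G ->
  pd c (fun p => F p * G p) = fun p => pd c F p * G p + F p * pd c G p.
Proof. intros; apply dlim_pd, dlim_mult; now apply sm_dlim with n. Qed.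

Lemma pd_jw (c : coord) (K : list nat) :
  pd c (fun p => jw p K) = fun _ => if coord_dec (W K) c then 1 else 0.
Proof. exact (dlim_pd c _ _ (dlim_coord c (W K))). Qed.

(* Any order of [G] would do in the two definitions below; see [series_eq]. *)
Definition order_of (n : nat) (G : jet -> R) : nat :=
  epsilon (inhabits 0%nat) (fun k => smooth n k G).

Definition series (n : nat) (T : list nat -> operator) (G : jet -> R) (p : jet) : R :=
  sumR (mindices n (order_of n G)) (fun M => T M (pd (W M) G) p).

(** Both truncations agree with the one at the larger order: beyond an order of [G] the derivative
    [pd (W M) G] is the zero function, and a linear [T M] kills it. *)
Lemma series_eq (n k : nat) (T : list nat -> operator) (G : jet -> R) :
  (forall M, valid n M -> linear n (T M)) -> smooth n k G ->
  series n T G = fun p => sumR (mindices n k) (fun M => T M (pd (W M) G) p).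
Proof.
  intros HT HG.
  assert (HG' : smooth n (order_of n G) G)
    by (apply (epsilon_spec (inhabits 0%nat) (fun k => smooth n k G)); now exists k).
  assert (H : forall j N p, (j <= N)%nat -> smooth n j G ->
            sumR (mindices n N) (fun M => T M (pd (W M) G) p) =
            sumR (mindices n j) (fun M => T M (pd (W M) G) p)).
  { intros j N p Hj HGj; apply sumR_mindices_mono; auto; intros M HM HMj.
    rewrite (pd_inadm n j G (W M) HGj HMj).
    rewrite (linear_zero n); auto; apply HT; now apply in_mindices in HM. }
  extensionality p; unfold series.
  rewrite <- (H _ (max k (order_of n G)) p) by (auto; lia).
  rewrite H with (j := k); auto; lia.
Qed.

Lemma linear_series (n : nat) (T : list nat -> operator) :
  (forall M, valid n M -> linear n (T M)) -> linear n (series n T).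
Proof.
  intros HT.
  assert (HM : forall k M, In M (mindices n k) -> linear n (T M)).
  { intros k M H; apply HT; now apply in_mindices in H. }
  split; [|split].
  - intros F [k HF]; rewrite (series_eq n k T F HT HF).
    apply sm_sumR; intros M H; apply (HM k M H); apply sm_pd; now exists k.
  - intros F G HF HG; destruct (sm_common n F G HF HG) as (k & HF' & HG').
    rewrite (series_eq n k T _ HT (smooth_plus n k F G HF' HG')),
      (series_eq n k T F HT HF'), (series_eq n k T G HT HG').
    extensionality p; rewrite <- sumR_plus; apply sumR_ext; intros M H.
    rewrite (proj1 (proj2 (linear_pd n (W M)))) by auto.
    now rewrite (proj1 (proj2 (HM k M H))) by now apply sm_pd.
  - intros a F [k HF].
    rewrite (series_eq n k T _ HT (smooth_scal n k a F HF)), (series_eq n k T F HT HF).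
    extensionality p; rewrite <- sumR_scal; apply sumR_ext; intros M H.
    rewrite (proj2 (proj2 (linear_pd n (W M)))) by now exists k.
    rewrite (proj2 (proj2 (HM k M H))); auto; apply sm_pd; now exists k.
Qed.

(** * Total derivatives *)

Definition D (n i : nat) : operator := fun G p =>
  pd (X i) G p + series n (fun M H p => jw p (insert i M) * H p) G p.

Lemma linear_D_terms (n i : nat) (M : list nat) : (i < n)%nat -> valid n M ->
  linear n (fun H p => jw p (insert i M) * H p).
Proof. intros Hi HM; apply linear_mult; [now apply sm_coord, valid_insert | apply linear_id]. Qed.

Lemma linear_D (n i : nat) : (i < n)%nat -> linear n (D n i).
Proof.
  intros Hi; apply linear_plus; [apply linear_pd | apply linear_series].
  intros; now apply linear_D_terms.
Qed.

Lemma D_eq (n k i : nat) (G : jet -> R) : (i < n)%nat -> smooth n k G ->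
  D n i G = Dtot n k i G.
Proof.
  intros Hi HG; unfold D; extensionality p.
  rewrite (series_eq n k); auto; intros; now apply linear_D_terms.
Qed.

Lemma smooth_D (n k i : nat) (G : jet -> R) : (i < n)%nat -> smooth n k G ->
  smooth n (S k) (D n i G).
Proof.
  intros Hi HG; rewrite (D_eq n k) by auto; unfold Dtot.
  assert (HG' : forall c, smooth n (S k) (pd c G)).
  { intros c; apply smooth_mono with k; [lia | now apply smooth_pd]. }
  apply smooth_plus; auto; apply smooth_sumR; intros M HM; apply smooth_mult; auto.
  apply (smooth_coord n (S k) (W (insert i M))), in_mindices.
  rewrite in_mindices in HM; rewrite length_insert; split; [lia | now apply valid_insert].
Qed.

Lemma D_mult (n i : nat) (F G : jet -> R) : (i < n)%nat -> sm n F -> sm n G ->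
  D n i (fun p => F p * G p) = fun p => D n i F p * G p + F p * D n i G p.
Proof.
  intros Hi HF HG; destruct (sm_common n F G HF HG) as (k & HF' & HG').
  rewrite !(D_eq n k) by (auto; now apply smooth_mult).
  extensionality p; unfold Dtot; rewrite !(pd_mult n) by auto.
  rewrite (sumR_ext _ _ (fun J => G p * (jw p (insert i J) * pd (W J) F p)
                               + F p * (jw p (insert i J) * pd (W J) G p))).
  - rewrite sumR_plus, !sumR_scal; ring.
  - intros J _; rewrite (pd_mult n) by auto; ring.
Qed.

Lemma D_jw (n i : nat) (K : list nat) : (i < n)%nat -> valid n K ->
  D n i (fun p => jw p K) = fun p => jw p (insert i K).
Proof.
  intros Hi HK; rewrite (D_eq n (length K)); auto.
  2:{ apply (smooth_coord n _ (W K)); now apply admissible_valid. }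
  extensionality p; unfold Dtot; rewrite pd_jw.
  destruct (coord_dec (W K) (X i)) as [|_]; [easy|].
  rewrite (sumR_ext _ _
    (fun J => if list_eq_dec Nat.eq_dec K J then jw p (insert i J) else 0)).
  - rewrite sumR_delta; [ring|apply NoDup_mindices|apply in_mindices; auto].
  - intros J _; rewrite pd_jw.
    destruct (coord_dec (W K) (W J)), (list_eq_dec Nat.eq_dec K J); try congruence; ring.
Qed.

Lemma pd_X_D (n i j : nat) (G : jet -> R) : (i < n)%nat -> sm n G ->
  pd (X j) (D n i G) = D n i (pd (X j) G).
Proof.
  intros Hi [k HG].
  assert (HG' : sm n G) by now exists k.
  rewrite (D_eq n k), (D_eq n k) by (auto; now apply smooth_pd); unfold Dtot.
  rewrite (proj1 (proj2 (linear_pd n (X j)))).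
  2: now apply sm_pd.
  2:{ apply sm_sumR; intros M HM; apply sm_mult; [|now apply sm_pd].
      apply sm_coord, valid_insert; auto; now apply in_mindices in HM. }
  rewrite (sm_pd_comm n (X j) (X i)) by auto.
  rewrite (linear_sumR n (pd (X j))); [|apply linear_pd|].
  - extensionality p; f_equal; apply sumR_ext; intros M HM.
    rewrite (pd_mult n), pd_jw, (sm_pd_comm n (X j) (W M)); auto; [| |now apply sm_pd].
    + destruct (coord_dec (W (insert i M)) (X j)); [easy|]; ring.
    + apply sm_coord, valid_insert; auto; now apply in_mindices in HM.
  - intros M HM; apply sm_mult; [|now apply sm_pd].
    apply sm_coord, valid_insert; auto; now apply in_mindices in HM.
Qed.

(** The extra sum comes from differentiating the coefficients [jw p (insert i J)]. At most one [J]
    contributes, [M] with one letter [i] removed; writing a sum avoids deciding whether [M] contains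
    [i]. *)
Lemma pd_W_D (n k i : nat) (M : list nat) (G : jet -> R) : (i < n)%nat -> smooth n k G ->
  pd (W M) (D n i G) = fun p => D n i (pd (W M) G) p +
    sumR (mindices n k) (fun J =>
      if list_eq_dec Nat.eq_dec (insert i J) M then pd (W J) G p else 0).
Proof.
  intros Hi HG.
  assert (HG' : sm n G) by now exists k.
  assert (Hc : forall J, In J (mindices n k) -> sm n (fun p => jw p (insert i J))).
  { intros J HJ; apply sm_coord, valid_insert; auto; now apply in_mindices in HJ. }
  rewrite (D_eq n k), (D_eq n k) by (auto; now apply smooth_pd); unfold Dtot.
  rewrite (proj1 (proj2 (linear_pd n (W M)))).
  2: now apply sm_pd.
  2:{ apply sm_sumR; intros J HJ; apply sm_mult; [now apply Hc|now apply sm_pd]. }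
  rewrite (sm_pd_comm n (W M) (X i)) by auto.
  rewrite (linear_sumR n (pd (W M))); [|apply linear_pd|].
  - extensionality p; rewrite Rplus_assoc; f_equal; rewrite <- sumR_plus.
    apply sumR_ext; intros J HJ.
    rewrite (pd_mult n), pd_jw, (sm_pd_comm n (W M) (W J)); auto; [|now apply sm_pd].
    destruct (coord_dec (W (insert i J)) (W M)),
      (list_eq_dec Nat.eq_dec (insert i J) M); try congruence; ring.
  - intros J HJ; apply sm_mult; [now apply Hc|now apply sm_pd].
Qed.

(* The commutator of [pd (W M)] with a total derivative turns multi-indices [M]
   into [insert j J]: this is integration by parts for [series]. *)
Lemma series_D (n j : nat) (T : list nat -> operator) (G : jet -> R) :
  (j < n)%nat -> sm n G -> (forall M, valid n M -> linear n (T M)) ->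
  series n T (D n j G) = fun p =>
    series n (fun M H => T M (D n j H)) G p + series n (fun J => T (insert j J)) G p.
Proof.
  intros Hj [k HG] HT.
  assert (HG' : sm n G) by now exists k.
  rewrite (series_eq n (S k) T _ HT (smooth_D n k j G Hj HG)).
  rewrite (series_eq n (S k) (fun M H => T M (D n j H)) G).
  2:{ intros M HM; apply linear_comp; auto using linear_D. }
  2:{ apply smooth_mono with k; auto. }
  rewrite (series_eq n k (fun J => T (insert j J)) G); auto.
  2:{ intros M HM; apply HT; now apply valid_insert. }
  extensionality p.
  (* The second series is spread over all [M] with a delta at [M = insert j J]. The bound [S k]
     makes room for these longer words, and both sides become sums over the same index set. *)
  rewrite (sumR_ext (mindices n k) (fun J => T (insert j J) (pd (W J) G) p)
    (fun J => sumR (mindices n (S k)) (fun M =>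
       if list_eq_dec Nat.eq_dec (insert j J) M then T M (pd (W J) G) p else 0))).
  - rewrite sumR_swap, <- sumR_plus; apply sumR_ext; intros M HM.
    assert (HTM : linear n (T M)) by (apply HT; now apply in_mindices in HM).
    rewrite (pd_W_D n k) by auto.
    assert (Hsm : forall J, In J (mindices n k) -> sm n (fun p =>
      if list_eq_dec Nat.eq_dec (insert j J) M then pd (W J) G p else 0)).
    { intros J _; destruct (list_eq_dec Nat.eq_dec (insert j J) M);
        [now apply sm_pd|apply sm_const]. }
    rewrite (proj1 (proj2 HTM));
      [|apply linear_D; auto; now apply sm_pd | now apply sm_sumR].
    rewrite (linear_sumR n (T M)) by auto; f_equal; apply sumR_ext; intros J _.
    destruct (list_eq_dec Nat.eq_dec (insert j J) M); auto.
    now rewrite (linear_zero n).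
  - intros J HJ; symmetry.
    apply (sumR_delta (list_eq_dec Nat.eq_dec) _ _ (fun M => T M (pd (W J) G) p)).
    + apply NoDup_mindices.
    + rewrite in_mindices in *; rewrite length_insert; split; [lia|now apply valid_insert].
Qed.

(** Expanding the outer [D n i] by [series_D] leaves a term with coefficient w_{Jji}; on the other
    side [D n j] falls on the coefficient w_{Ji} and gives w_{Jij}. They agree by [insert_comm]. *)
Lemma D_comm (n i j : nat) (G : jet -> R) : (i < n)%nat -> (j < n)%nat -> sm n G ->
  D n i (D n j G) = D n j (D n i G).
Proof.
  intros Hi Hj [k HG].
  assert (HG' : sm n G) by now exists k.
  assert (Hc : forall J, In J (mindices n k) -> sm n (fun p => jw p (insert i J))).
  { intros J HJ; apply sm_coord, valid_insert; auto; now apply in_mindices in HJ. }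
  assert (HT : forall M, valid n M -> linear n (fun H p => jw p (insert i M) * H p))
    by (intros; now apply linear_D_terms).
  unfold D at 1; rewrite (series_D n j) by auto; rewrite pd_X_D by auto.
  unfold D at 4; rewrite (proj1 (proj2 (linear_D n j Hj)));
    [|now apply sm_pd | now apply linear_series].
  rewrite (series_eq n k _ G HT HG).
  rewrite (linear_sumR n (D n j)); [| |intros J HJ; apply sm_mult; auto; now apply sm_pd].
  2: now apply linear_D.
  extensionality p; f_equal.
  rewrite (series_eq n k), (series_eq n k), <- sumR_plus; auto.
  - apply sumR_ext; intros J HJ; rewrite D_mult; auto; [|now apply sm_pd].
    rewrite D_jw, (insert_comm i j); auto; [ring|].
    apply valid_insert; auto; now apply in_mindices in HJ.
  - intros M HM; apply linear_D_terms; auto using valid_insert.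
  - intros M HM; apply linear_mult; [now apply sm_coord, valid_insert|now apply linear_D].
Qed.

(** * Euler operators *)

Fixpoint DM (n : nat) (M : list nat) (G : jet -> R) : jet -> R :=
  match M with
  | [] => G
  | a :: M' => D n a (DM n M' G)
  end.

(* The Leibniz derivative of the word [M] with respect to the letter [i]; by
   [pd_DM] it is the coefficient of [pd (W [])] in the commutator of
   [pd (W [i])] with [DM n M]. *)
Fixpoint DM_deriv (n i : nat) (M : list nat) (G : jet -> R) : jet -> R :=
  match M with
  | [] => fun _ => 0
  | a :: M' => fun p => D n a (DM_deriv n i M' G) p
                        + (if Nat.eq_dec i a then DM n M' G p else 0)
  end.

Definition euler (n : nat) : operator :=
  series n (fun M H p => (-1) ^ length M * DM n M H p).

(* A higher Euler operator; up to sign it is the [D_i]-coefficient of the formal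
   adjoint of the linearization of its argument. *)
Definition euler1 (n i : nat) : operator :=
  series n (fun M H p => (-1) ^ length M * DM_deriv n i M H p).

Lemma linear_DM (n : nat) (M : list nat) :
  Forall (fun a => (a < n)%nat) M -> linear n (DM n M).
Proof.
  induction 1 as [|a M Ha HM IH]; simpl; [apply linear_id|].
  apply (linear_comp n (D n a)); auto using linear_D.
Qed.

Lemma linear_if (n : nat) (P : Prop) (b : {P} + {~ P}) (T : operator) :
  linear n T -> linear n (fun H p => if b then T H p else 0).
Proof. destruct b; [auto|intros; apply linear_null]. Qed.

Lemma linear_DM_deriv (n i : nat) (M : list nat) :
  Forall (fun a => (a < n)%nat) M -> linear n (DM_deriv n i M).
Proof.
  induction 1 as [|a M Ha HM IH]; simpl; [apply linear_null|].
  apply (linear_plus n (fun H => D n a (DM_deriv n i M H))).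
  - apply (linear_comp n (D n a)); auto using linear_D.
  - now apply linear_if, linear_DM.
Qed.

Lemma linear_euler_terms (n : nat) (M : list nat) : valid n M ->
  linear n (fun H p => (-1) ^ length M * DM n M H p).
Proof. intros [_ HM]; now apply linear_scal, linear_DM. Qed.

Lemma linear_euler1_terms (n i : nat) (M : list nat) : valid n M ->
  linear n (fun H p => (-1) ^ length M * DM_deriv n i M H p).
Proof. intros [_ HM]; now apply linear_scal, linear_DM_deriv. Qed.

Lemma linear_euler1 (n i : nat) : linear n (euler1 n i).
Proof. apply linear_series, linear_euler1_terms. Qed.

Lemma DM_D (n j : nat) (M : list nat) (G : jet -> R) :
  (j < n)%nat -> Forall (fun a => (a < n)%nat) M -> sm n G ->
  DM n M (D n j G) = D n j (DM n M G).
Proof.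
  intros Hj HM HG; induction HM as [|a M Ha HM IH]; simpl; auto.
  rewrite IH; apply D_comm; auto; now apply linear_DM.
Qed.

Lemma DM_insert (n j : nat) (M : list nat) (G : jet -> R) :
  (j < n)%nat -> Forall (fun a => (a < n)%nat) M -> sm n G ->
  DM n (insert j M) G = D n j (DM n M G).
Proof.
  intros Hj HM HG; induction HM as [|a M Ha HM IH]; simpl; auto.
  destruct (Nat.leb j a); simpl; auto.
  rewrite IH; apply D_comm; auto; now apply linear_DM.
Qed.

Lemma D_if (n j : nat) (P : Prop) (b : {P} + {~ P}) (G : jet -> R) : (j < n)%nat ->
  D n j (fun p => if b then G p else 0) = fun p => if b then D n j G p else 0.
Proof. intros Hj; destruct b; auto; apply (linear_zero n); now apply linear_D. Qed.

Lemma D_DM_deriv_cons (n i j a : nat) (M : list nat) (G : jet -> R) :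
  (j < n)%nat -> (a < n)%nat -> Forall (fun a => (a < n)%nat) M -> sm n G ->
  D n j (DM_deriv n i (a :: M) G) = fun p =>
    D n a (D n j (DM_deriv n i M G)) p + (if Nat.eq_dec i a then D n j (DM n M G) p else 0).
Proof.
  intros Hj Ha HM HG.
  assert (HR : sm n (DM_deriv n i M G)) by now apply linear_DM_deriv.
  simpl; rewrite (proj1 (proj2 (linear_D n j Hj))).
  - now rewrite D_if, D_comm.
  - now apply linear_D.
  - apply (linear_if n _ _ (DM n M)); auto; now apply linear_DM.
Qed.

Lemma DM_deriv_D (n i j : nat) (M : list nat) (G : jet -> R) :
  (j < n)%nat -> Forall (fun a => (a < n)%nat) M -> sm n G ->
  DM_deriv n i M (D n j G) = D n j (DM_deriv n i M G).
Proof.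
  intros Hj HM HG; induction HM as [|a M Ha HM IH].
  - simpl; symmetry; apply (linear_zero n); now apply linear_D.
  - rewrite D_DM_deriv_cons by auto; simpl; now rewrite IH, DM_D.
Qed.

(** Because total derivatives commute, the Leibniz derivative does not depend on where the sorted
    insertion puts the new letter, which may be treated as the first. *)
Lemma DM_deriv_insert (n i j : nat) (M : list nat) (G : jet -> R) :
  (j < n)%nat -> Forall (fun a => (a < n)%nat) M -> sm n G ->
  DM_deriv n i (insert j M) G = fun p =>
    D n j (DM_deriv n i M G) p + (if Nat.eq_dec i j then DM n M G p else 0).
Proof.
  intros Hj HM HG; induction HM as [|a M Ha HM IH]; simpl insert; auto.
  destruct (Nat.leb j a); auto.
  rewrite D_DM_deriv_cons by auto.
  assert (HR : sm n (DM_deriv n i M G)) by now apply linear_DM_deriv.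
  assert (HDM : sm n (DM n M G)) by now apply linear_DM.
  cbn [DM_deriv DM]; rewrite IH, DM_insert by auto.
  rewrite (proj1 (proj2 (linear_D n a Ha))), D_if; auto.
  - extensionality p; ring.
  - now apply linear_D.
  - apply (linear_if n _ _ (DM n M)); auto; now apply linear_DM.
Qed.

Lemma pd_W0_D (n a : nat) (G : jet -> R) : (a < n)%nat -> sm n G ->
  pd (W []) (D n a G) = D n a (pd (W []) G).
Proof.
  intros Ha [k HG]; rewrite (pd_W_D n k) by auto; extensionality p.
  rewrite sumR_zero; [ring|]; intros J _.
  destruct (list_eq_dec Nat.eq_dec (insert a J) []) as [E|]; auto.
  now apply (f_equal (@length nat)) in E; rewrite length_insert in E.
Qed.

Lemma pd_W1_D (n i a : nat) (G : jet -> R) : (a < n)%nat -> sm n G ->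
  pd (W [i]) (D n a G) = fun p =>
    D n a (pd (W [i]) G) p + (if Nat.eq_dec i a then pd (W []) G p else 0).
Proof.
  intros Ha [k HG]; rewrite (pd_W_D n k) by auto; extensionality p; f_equal.
  rewrite (sumR_ext _ _ (fun J => if list_eq_dec Nat.eq_dec [] J
             then (if Nat.eq_dec i a then pd (W J) G p else 0) else 0)).
  - rewrite sumR_delta; auto using NoDup_mindices.
    apply in_mindices; split; [simpl; lia|]; split; constructor.
  - intros J _; destruct (list_eq_dec Nat.eq_dec [] J) as [<-|ne].
    + change (insert a []) with [a].
      destruct (list_eq_dec Nat.eq_dec [a] [i]), (Nat.eq_dec i a); congruence.
    + destruct (list_eq_dec Nat.eq_dec (insert a J) [i]) as [E|]; auto.
      apply (f_equal (@length nat)) in E; rewrite length_insert in E.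
      now destruct J.
Qed.

Lemma pd_W0_DM (n : nat) (M : list nat) (G : jet -> R) :
  Forall (fun a => (a < n)%nat) M -> sm n G ->
  pd (W []) (DM n M G) = DM n M (pd (W []) G).
Proof.
  intros HM HG; induction HM as [|a M Ha HM IH]; simpl; auto.
  rewrite pd_W0_D, IH; auto; now apply linear_DM.
Qed.

Lemma pd_DM (n i : nat) (M : list nat) (G : jet -> R) :
  Forall (fun a => (a < n)%nat) M -> sm n G ->
  pd (W [i]) (DM n M G) = fun p =>
    DM n M (pd (W [i]) G) p + DM_deriv n i M (pd (W []) G) p.
Proof.
  intros HM HG; induction HM as [|a M Ha HM IH]; simpl.
  - extensionality p; ring.
  - rewrite pd_W1_D, IH, pd_W0_DM by (auto; now apply linear_DM).
    rewrite (proj1 (proj2 (linear_D n a Ha))).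
    + extensionality p; ring.
    + apply linear_DM; auto; now apply sm_pd.
    + apply linear_DM_deriv; auto; now apply sm_pd.
Qed.

(** In [series_D] the second series has words longer by one, hence the opposite sign, and the two
    series cancel term by term. *)
Lemma euler_D (n j : nat) (G : jet -> R) : (j < n)%nat -> sm n G ->
  euler n (D n j G) = fun _ => 0.
Proof.
  intros Hj HG; unfold euler; rewrite series_D by (auto using linear_euler_terms).
  destruct HG as [k HG]; rewrite !(series_eq n k); auto.
  - extensionality p; rewrite <- sumR_plus; apply sumR_zero; intros M HM.
    apply in_mindices in HM; destruct HM as (_ & _ & HM).
    assert (HG' : sm n (pd (W M) G)) by (apply sm_pd; now exists k).
    rewrite DM_insert, DM_D, length_insert by auto; simpl; ring.
  - intros M HM; now apply linear_euler_terms, valid_insert.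
  - intros M HM; apply (linear_comp n (fun H p => (-1) ^ length M * DM n M H p));
      auto using linear_D, linear_euler_terms.
Qed.

(** The same cancellation, except that the Leibniz derivative of [insert j M] has one more term,
    from the inserted letter itself. These surplus terms form minus the Euler series when
    [i = j]. *)
Lemma euler1_D (n i j : nat) (G : jet -> R) : (j < n)%nat -> sm n G ->
  euler1 n i (D n j G) = fun p => - (if Nat.eq_dec i j then euler n G p else 0).
Proof.
  intros Hj HG; unfold euler1; rewrite series_D by (auto using linear_euler1_terms).
  destruct HG as [k HG].
  rewrite !(series_eq n k); auto.
  - unfold euler; rewrite (series_eq n k) by auto using linear_euler_terms.
    extensionality p; rewrite <- sumR_plus.
    replace (- (if Nat.eq_dec i j then _ else 0)) with
      ((-1) * sumR (mindices n k) (fun M => if Nat.eq_dec i j then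
          (-1) ^ length M * DM n M (pd (W M) G) p else 0)).
    2:{ destruct (Nat.eq_dec i j); [ring|]; rewrite sumR_zero; auto; ring. }
    rewrite <- sumR_scal; apply sumR_ext; intros M HM.
    apply in_mindices in HM; destruct HM as (_ & _ & HM).
    assert (HG' : sm n (pd (W M) G)) by (apply sm_pd; now exists k).
    rewrite DM_deriv_insert, DM_deriv_D, length_insert by auto; simpl.
    destruct (Nat.eq_dec i j); ring.
  - intros M HM; now apply linear_euler1_terms, valid_insert.
  - intros M HM; apply (linear_comp n (fun H p => (-1) ^ length M * DM_deriv n i M H p));
      auto using linear_D, linear_euler1_terms.
Qed.

(** From length two on, stripping the first letter leaves at most the Euler operator of a total
    derivative, which is zero. *)
Lemma euler1_DM (n i : nat) (M : list nat) (G : jet -> R) :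
  Forall (fun a => (a < n)%nat) M -> sm n G ->
  euler1 n i (DM n M G) = fun p =>
    match M with
    | [] => euler1 n i G p
    | [j] => - (if Nat.eq_dec i j then euler n G p else 0)
    | _ => 0
    end.
Proof.
  intros HM HG; destruct HM as [|a M Ha HM]; auto.
  destruct HM as [|b M Hb HM]; [now apply euler1_D|].
  assert (HGM : sm n (DM n M G)) by now apply linear_DM.
  simpl; rewrite euler1_D; auto; [|now apply linear_D].
  rewrite euler_D by auto; extensionality p; destruct (Nat.eq_dec i a); ring.
Qed.

Lemma euler1_euler (n i : nat) (G : jet -> R) : (i < n)%nat -> sm n G ->
  euler1 n i (euler n G) = pd (W [i]) (euler n G).
Proof.
  intros Hi [k0 HG0].
  (* The order is raised to at least 1 so that [[i]] occurs in [mindices n k] even when [G] has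
     order 0. *)
  assert (HG : smooth n (S k0) G) by (apply smooth_mono with k0; auto).
  clear HG0; set (k := S k0) in *.
  assert (HGM : forall M, sm n (pd (W M) G)) by (intros; apply sm_pd; now exists k).
  unfold euler at 1 2; rewrite (series_eq n k) by auto using linear_euler_terms.
  assert (Hterm : forall M, In M (mindices n k) ->
            sm n (fun p => (-1) ^ length M * DM n M (pd (W M) G) p)).
  { intros M HM; apply in_mindices in HM.
    apply (linear_euler_terms n M); [apply HM|apply HGM]. }
  rewrite (linear_sumR n (euler1 n i)) by auto using linear_euler1.
  rewrite (linear_sumR n (pd (W [i]))) by auto using linear_pd.
  extensionality p.
  (* Only the words [[]] and [[i]] survive. For [[i]] the sign of the word cancels the sign in
     [euler1_DM], leaving Q_i(f_w) + E(f_{w_i}), which [pd_DM] matches with the derivative of E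
     f. *)
  rewrite (sumR_ext _ _ (fun M =>
     (if list_eq_dec Nat.eq_dec [] M then euler1 n i (pd (W M) G) p else 0) +
     (if list_eq_dec Nat.eq_dec [i] M then euler n (pd (W M) G) p else 0))).
  2:{ intros M HM; apply in_mindices in HM; destruct HM as (_ & _ & HM).
      rewrite (proj2 (proj2 (linear_euler1 n i))) by (apply linear_DM; auto).
      rewrite euler1_DM by auto.
      destruct (list_eq_dec Nat.eq_dec [] M) as [E|];
        [|destruct (list_eq_dec Nat.eq_dec [i] M) as [E|]];
        try subst M; simpl.
      - destruct (list_eq_dec Nat.eq_dec [i] []); [easy|ring].
      - destruct (Nat.eq_dec i i); [ring|easy].
      - destruct M as [|a [|b M]]; [easy| |ring].
        destruct (Nat.eq_dec i a); [congruence|ring]. }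
  rewrite sumR_plus.
  assert (V0 : valid n []) by (split; constructor).
  assert (V1 : valid n [i]) by (split; repeat constructor; auto).
  rewrite (sumR_delta (list_eq_dec Nat.eq_dec) _ []) by
    (auto using NoDup_mindices; apply in_mindices; simpl; split; auto; lia).
  rewrite (sumR_delta (list_eq_dec Nat.eq_dec) _ [i]) by
    (auto using NoDup_mindices; apply in_mindices; simpl; split; auto; unfold k; lia).
  unfold euler, euler1; rewrite !(series_eq n k)
    by (auto using linear_euler_terms, linear_euler1_terms; now apply smooth_pd).
  rewrite <- sumR_plus; apply sumR_ext; intros M HM; apply in_mindices in HM.
  destruct HM as (_ & _ & HM).
  rewrite (proj2 (proj2 (linear_pd n (W [i])))) by (apply linear_DM; auto).
  rewrite pd_DM by auto.
  rewrite (sm_pd_comm n (W [i]) (W M)), (sm_pd_comm n (W []) (W M)) by now exists k.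
  ring.
Qed.

Lemma Dmulti_eq (n j N : nat) (M : list nat) (G : jet -> R) :
  Forall (fun a => (a < n)%nat) M -> smooth n j G -> (j + length M <= N)%nat ->
  Dmulti n N M G = DM n M G /\ smooth n (j + length M) (DM n M G).
Proof.
  intros HM HG; induction HM as [|a M Ha HM IH]; simpl; intros HN.
  - split; auto; now rewrite Nat.add_0_r.
  - destruct IH as [E H]; [lia|]; rewrite E; split.
    + symmetry; apply D_eq; auto; apply smooth_mono with (j + length M)%nat; auto; lia.
    + rewrite Nat.add_succ_r; now apply smooth_D.
Qed.

(** The truncation at [2 * k] is exact: [pd (W M) f] has order at most [k], and at most [k] total
    derivatives follow, each raising the order by one. *)
Lemma EL_euler (n k : nat) (f : jet -> R) : smooth n k f -> EL n k f = euler n f.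
Proof.
  intros Hf; unfold euler; rewrite (series_eq n k) by auto using linear_euler_terms.
  extensionality p; apply sumR_ext; intros M HM; apply in_mindices in HM.
  rewrite (proj1 (Dmulti_eq n k (2 * k) M (pd (W M) f)
    (proj2 (proj2 HM)) (smooth_pd n k _ f Hf) ltac:(lia))).
  reflexivity.
Qed.

(** * Helmholtz conditions for quasilinear second-order expressions *)

Lemma mindices_1 (n : nat) : mindices n 1 = [] :: map (fun i => [i]) (seq 0 n).
Proof.
  unfold mindices; simpl; rewrite app_nil_r; f_equal.
  induction (seq 0 n) as [|i l IH]; simpl; auto; now rewrite IH.
Qed.

Lemma D_order1 (n a : nat) (F : jet -> R) (p : jet) : (a < n)%nat -> smooth n 1 F ->
  D n a F p = pd (X a) F p + pd (W []) F p * jw p [a]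
    + sumR (seq 0 n) (fun b => pd (W [b]) F p * jw p (insert a [b])).
Proof.
  intros Ha HF; rewrite (D_eq n 1) by auto; unfold Dtot; rewrite mindices_1.
  change (sumR ([] :: ?l) ?f) with (f [] + sumR l f).
  rewrite sumR_map, Rplus_assoc; f_equal; f_equal; [apply Rmult_comm|].
  apply sumR_ext; intros; ring.
Qed.

Lemma DM_deriv_singleton (n i a : nat) (G : jet -> R) : (a < n)%nat ->
  DM_deriv n i [a] G = fun p => if Nat.eq_dec i a then G p else 0.
Proof.
  intros Ha; simpl; rewrite (linear_zero n) by now apply linear_D.
  extensionality p; ring.
Qed.

Lemma euler1_order1 (n i : nat) (F : jet -> R) : (i < n)%nat -> smooth n 1 F ->
  euler1 n i F = fun p => - pd (W [i]) F p.
Proof.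
  intros Hi HF; unfold euler1; rewrite (series_eq n 1) by auto using linear_euler1_terms.
  extensionality p.
  rewrite (sumR_ext _ _ (fun M =>
    if list_eq_dec Nat.eq_dec [i] M then - pd (W M) F p else 0)).
  - rewrite sumR_delta; auto using NoDup_mindices.
    apply in_mindices; split; auto; split; repeat constructor; auto.
  - intros M HM; rewrite in_mindices in HM; destruct HM as (Hl & _ & HM).
    destruct M as [|a [|b M]]; [simpl; ring| |simpl in Hl; lia].
    rewrite DM_deriv_singleton by (now inversion HM).
    destruct (list_eq_dec Nat.eq_dec [i] [a]), (Nat.eq_dec i a); simpl; try congruence; ring.
Qed.

Lemma sm_order (n k : nat) (F : jet -> R) : smooth n k F -> sm n F.
Proof. now exists k. Qed.

Lemma smooth_jw2 (n a b : nat) : (a < n)%nat -> (b < n)%nat ->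
  smooth n 2 (fun p => jw p (insert a [b])).
Proof.
  intros Ha Hb; apply (smooth_coord n 2 (W (insert a [b]))), in_mindices.
  rewrite length_insert; split; auto; apply valid_insert; auto.
  split; repeat constructor; auto.
Qed.

(** Words of length one only differentiate [F], words of length two only the coordinate w_ab. The
    latter leaves the word ab acting on [F], and each of its two letters gives one Leibniz term. *)
Lemma euler1_quasilinear_term (n i a b : nat) (F : jet -> R) :
  (i < n)%nat -> (a < n)%nat -> (b < n)%nat -> smooth n 1 F ->
  euler1 n i (fun p => F p * jw p (insert a [b])) = fun p =>
    - (pd (W [i]) F p * jw p (insert a [b]))
    + ((if Nat.eq_dec i b then D n a F p else 0) + (if Nat.eq_dec i a then D n b F p else 0)).
Proof.
  intros Hi Ha Hb HF.
  assert (HF2 : smooth n 2 F) by (apply smooth_mono with 1%nat; auto).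
  pose proof (smooth_jw2 n a b Ha Hb) as Hw.
  unfold euler1; rewrite (series_eq n 2) by (auto using linear_euler1_terms, smooth_mult).
  extensionality p.
  rewrite (sumR_ext _ _ (fun M =>
    (if list_eq_dec Nat.eq_dec [i] M then - (pd (W M) F p * jw p (insert a [b])) else 0) +
    (if list_eq_dec Nat.eq_dec (insert a [b]) M then DM_deriv n i M F p else 0))).
  - rewrite sumR_plus, !sumR_delta; auto using NoDup_mindices.
    + rewrite DM_deriv_insert, DM_deriv_singleton, D_if;
        auto; [now exists 1%nat].
    + apply in_mindices; rewrite length_insert; split; auto; apply valid_insert; auto.
      split; repeat constructor; auto.
    + apply in_mindices; simpl; split; auto; split; repeat constructor; auto.
  - intros M HM; pose proof HM as HM'.
    rewrite in_mindices in HM'; destruct HM' as (Hl & HV & HMn).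
    rewrite (pd_mult n), pd_jw by (eapply sm_order; eassumption).
    assert (Hlen := length_insert a [b]).
    destruct M as [|c [|d M]].
    + destruct (list_eq_dec Nat.eq_dec (insert a [b]) []) as [E|]; [now rewrite E in Hlen|].
      simpl; ring.
    + destruct (list_eq_dec Nat.eq_dec (insert a [b]) [c]) as [E|]; [now rewrite E in Hlen|].
      destruct (coord_dec (W (insert a [b])) (W [c])); [congruence|].
      rewrite DM_deriv_singleton by (now inversion HMn).
      destruct (list_eq_dec Nat.eq_dec [i] [c]), (Nat.eq_dec i c); simpl; try congruence; ring.
    + destruct (list_eq_dec Nat.eq_dec [i] (c :: d :: M)); [easy|].
      rewrite (pd_inadm n 1 F (W (c :: d :: M))); auto.
      2:{ intros E; apply in_mindices in E; destruct E as [E _]; simpl in E; lia. }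
      assert (HR := linear_DM_deriv n i (c :: d :: M) HMn).
      assert (length M = 0)%nat by (simpl in Hl; lia).
      replace (length (c :: d :: M)) with 2%nat by (simpl; lia).
      destruct (coord_dec (W (insert a [b])) (W (c :: d :: M))),
        (list_eq_dec Nat.eq_dec (insert a [b]) (c :: d :: M)); try congruence.
      * replace (fun q => 0 * jw q (insert a [b]) + F q * 1) with F
          by (extensionality q; ring).
        ring.
      * replace (fun q => 0 * jw q (insert a [b]) + F q * 0) with (fun _ : jet => 0)
          by (extensionality q; ring).
        rewrite (linear_zero n) by auto; ring.
Qed.

Lemma sumR_seq_delta (n i : nat) (f : nat -> R) : (i < n)%nat ->
  sumR (seq 0 n) (fun a => if Nat.eq_dec i a then f a else 0) = f i.
Proof.
  intros Hi; apply (sumR_delta Nat.eq_dec); [apply seq_NoDup|rewrite in_seq; lia].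
Qed.

Definition quasilinear (n : nat) (F1 : jet -> R) (F2 : nat -> nat -> jet -> R) (p : jet) : R :=
  F1 p - sumR (seq 0 n) (fun i => sumR (seq 0 n) (fun i' => F2 i i' p * jw p (insert i [i']))).

Lemma quasilinear_self_adjoint (n : nat) (F1 : jet -> R) (F2 : nat -> nat -> jet -> R)
  (f : jet -> R) (i : nat) :
  smooth n 1 F1 ->
  (forall a b, (a < n)%nat -> (b < n)%nat -> smooth n 1 (F2 a b)) ->
  (forall a b, (a < n)%nat -> (b < n)%nat -> F2 a b = F2 b a) ->
  sm n f -> euler n f = quasilinear n F1 F2 -> (i < n)%nat ->
  forall p, pd (W [i]) F1 p + sumR (seq 0 n) (fun a => D n a (F2 a i) p)
    = sumR (seq 0 n) (fun a => sumR (seq 0 n) (fun b =>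
        pd (W [i]) (F2 a b) p * jw p (insert a [b]))).
Proof.
  intros HF1 HF2 Hsym Hf Hfe Hi p.
  pose proof (euler1_euler n i f Hi Hf) as H; rewrite Hfe in H.
  assert (E : quasilinear n F1 F2 = fun p => F1 p + (-1) *
    sumR (seq 0 n) (fun a => sumR (seq 0 n) (fun b => F2 a b p * jw p (insert a [b])))).
  { extensionality q; unfold quasilinear; ring. }
  rewrite E in H; clear E.
  assert (Hab : forall a b, In a (seq 0 n) -> In b (seq 0 n) ->
            sm n (fun p => F2 a b p * jw p (insert a [b]))).
  { intros a b Ha Hb; rewrite in_seq in *.
    apply sm_mult; [exists 1%nat; apply HF2; lia|exists 2%nat; apply smooth_jw2; lia]. }
  assert (lin : forall T, linear n T ->
    T (fun p => F1 p + (-1) * sumR (seq 0 n) (fun a => sumR (seq 0 n) (fun b =>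
                  F2 a b p * jw p (insert a [b])))) p =
    T F1 p - sumR (seq 0 n) (fun a => sumR (seq 0 n) (fun b =>
                  T (fun p => F2 a b p * jw p (insert a [b])) p))).
  { intros T HT.
    assert (Hs : forall a, In a (seq 0 n) -> sm n (fun p => sumR (seq 0 n) (fun b =>
                  F2 a b p * jw p (insert a [b])))) by (intros; apply sm_sumR; auto).
    rewrite (proj1 (proj2 HT)); [| now exists 1%nat |].
    2:{ apply sm_mult; [apply sm_const|]; now apply sm_sumR. }
    rewrite (proj2 (proj2 HT)) by now apply sm_sumR.
    rewrite (linear_sumR n T) by auto.
    rewrite (sumR_ext (seq 0 n) _ (fun a => sumR (seq 0 n) (fun b =>
                  T (fun p => F2 a b p * jw p (insert a [b])) p))); [ring|].
    intros a Ha; now rewrite (linear_sumR n T) by auto. }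
  apply (f_equal (fun G => G p)) in H.
  rewrite (lin _ (linear_euler1 n i)), (lin _ (linear_pd n (W [i]))) in H; clear lin.
  rewrite (euler1_order1 n i F1 Hi HF1) in H.
  set (S := sumR (seq 0 n) (fun a => sumR (seq 0 n) (fun b =>
              pd (W [i]) (F2 a b) p * jw p (insert a [b])))) in *.
  set (T := sumR (seq 0 n) (fun a => D n a (F2 a i) p)) in *.
  (* Both letters of ab contribute, and by symmetry of [F2] they contribute the same sum [T]. With P
     the derivative of [F1], the identity reads -P + S - 2T = P - S, twice the claim. *)
  assert (E1 : sumR (seq 0 n) (fun a => sumR (seq 0 n) (fun b =>
     euler1 n i (fun p => F2 a b p * jw p (insert a [b])) p)) = - S + (T + T)).
  { rewrite (sumR_ext _ _ (fun a => (-1) * sumR (seq 0 n) (fun b =>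
              pd (W [i]) (F2 a b) p * jw p (insert a [b])) +
       (D n a (F2 a i) p + if Nat.eq_dec i a then
           sumR (seq 0 n) (fun b => D n b (F2 a b) p) else 0))).
    - rewrite !sumR_plus, sumR_scal, sumR_seq_delta by auto; fold S T.
      rewrite (sumR_ext (seq 0 n) (fun b => D n b (F2 i b) p) (fun a => D n a (F2 a i) p)).
      + fold T; ring.
      + intros b Hb; rewrite in_seq in Hb; rewrite Hsym; auto; lia.
    - intros a Ha.
      rewrite (sumR_ext _ _ (fun b => (-1) * (pd (W [i]) (F2 a b) p * jw p (insert a [b])) +
        ((if Nat.eq_dec i b then D n a (F2 a b) p else 0) +
         (if Nat.eq_dec i a then D n b (F2 a b) p else 0)))).
      + rewrite !sumR_plus, sumR_scal, sumR_seq_delta by auto; do 2 f_equal.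
        destruct (Nat.eq_dec i a); auto; now apply sumR_zero.
      + intros b Hb; rewrite in_seq in *.
        rewrite euler1_quasilinear_term by (auto; try lia; apply HF2; lia); ring. }
  assert (E2 : sumR (seq 0 n) (fun a => sumR (seq 0 n) (fun b =>
     pd (W [i]) (fun p => F2 a b p * jw p (insert a [b])) p)) = S).
  { apply sumR_ext; intros a Ha; apply sumR_ext; intros b Hb; rewrite in_seq in *.
    rewrite (pd_mult n), pd_jw;
      [|exists 1%nat; apply HF2; lia|exists 2%nat; apply smooth_jw2; lia].
    destruct (coord_dec (W (insert a [b])) (W [i])) as [E|]; [|ring].
    assert (Hl := length_insert a [b]); assert (E' : insert a [b] = [i]) by congruence.
    now rewrite E' in Hl. }
  rewrite E1, E2 in H; lra.
Qed.

(** Functions of order one do not see this change, so an identity valid at all jets becomes affine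
    in the arbitrary values [z], with coefficients fixed at [p]. *)
Definition set_order2 (p : jet) (z : list nat -> R) : jet :=
  mkJet (jx p) (fun K => if Nat.eq_dec (length K) 2 then z K else jw p K).

Lemma order_le_set_order2 (n : nat) (G : jet -> R) (p : jet) (z : list nat -> R) :
  order_le n 1 G -> G (set_order2 p z) = G p.
Proof.
  intros H; apply H; auto; intros K HK; apply in_mindices in HK; simpl.
  destruct (Nat.eq_dec (length K) 2); auto; lia.
Qed.

Lemma symmetric_part_zero (n : nat) (c : nat -> nat -> R) :
  (forall z : list nat -> R, sumR (seq 0 n) (fun a => sumR (seq 0 n) (fun b =>
     z (insert a [b]) * c a b)) = 0) ->
  forall a b, (a < n)%nat -> (b < n)%nat -> c a b + c b a = 0.
Proof.
  intros H a b Ha Hb.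
  specialize (H (fun K => if list_eq_dec Nat.eq_dec K (insert a [b]) then 1 else 0)).
  assert (Hins : forall a' b', insert a' [b'] = insert a [b] <->
            (a = a' /\ b = b') \/ (b = a' /\ a = b')).
  { intros a' b'; simpl; destruct (Nat.leb_spec a b), (Nat.leb_spec a' b'); split;
      intros E; try (injection E as -> ->; tauto);
      destruct E as [[-> ->]|[-> ->]]; auto; try lia; now repeat f_equal; lia. }
  (* On the diagonal a single pair of indices meets the tested coordinate, off it the two pairs
     (a,b) and (b,a) do. *)
  destruct (Nat.eq_dec a b) as [<-|ne].
  - rewrite (sumR_ext _ _ (fun a' => if Nat.eq_dec a a' then c a' a else 0)) in H.
    + rewrite sumR_seq_delta in H by auto; lra.
    + intros a' _.
      rewrite (sumR_ext _ _ (fun b' => if Nat.eq_dec a b' then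
         (if Nat.eq_dec a a' then c a' b' else 0) else 0)); [now apply sumR_seq_delta|].
      intros b' _; destruct (list_eq_dec Nat.eq_dec (insert a' [b']) (insert a [a])) as [E|E];
        rewrite Hins in E; destruct (Nat.eq_dec a a'), (Nat.eq_dec a b'); subst; try tauto; ring.
  - rewrite (sumR_ext _ _ (fun a' => (if Nat.eq_dec a a' then c a' b else 0) +
                (if Nat.eq_dec b a' then c a' a else 0))) in H.
    + rewrite sumR_plus, !sumR_seq_delta in H by auto; lra.
    + intros a' _.
      rewrite (sumR_ext _ _ (fun b' =>
        (if Nat.eq_dec b b' then (if Nat.eq_dec a a' then c a' b' else 0) else 0) +
        (if Nat.eq_dec a b' then (if Nat.eq_dec b a' then c a' b' else 0) else 0))).
      * now rewrite sumR_plus, !sumR_seq_delta.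
      * intros b' _; destruct (list_eq_dec Nat.eq_dec (insert a' [b']) (insert a [b])) as [E|E];
        rewrite Hins in E; destruct (Nat.eq_dec a a'), (Nat.eq_dec b b'),
          (Nat.eq_dec b a'), (Nat.eq_dec a b'); subst; try tauto; ring.
Qed.

Lemma helmholtz_conditions (n : nat) (F1 : jet -> R) (F2 : nat -> nat -> jet -> R)
  (f : jet -> R) :
  smooth n 1 F1 ->
  (forall a b, (a < n)%nat -> (b < n)%nat -> smooth n 1 (F2 a b)) ->
  (forall a b, (a < n)%nat -> (b < n)%nat -> F2 a b = F2 b a) ->
  sm n f -> euler n f = quasilinear n F1 F2 ->
  (forall i i' i'', (i < n)%nat -> (i' < n)%nat -> (i'' < n)%nat -> forall p,
      pd (W [i'']) (F2 i i') p = pd (W [i']) (F2 i i'') p) /\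
  (forall i', (i' < n)%nat -> forall p,
      pd (W [i']) F1 p
      + sumR (seq 0 n) (fun i => pd (X i) (F2 i i') p)
      + sumR (seq 0 n) (fun i => pd (W []) (F2 i i') p * jw p [i]) = 0).
Proof.
  intros HF1 HF2 Hsym Hf Hfe.
  assert (Hpd : forall c G p z, smooth n 1 G -> pd c G (set_order2 p z) = pd c G p).
  { intros c G p z HG; apply order_le_set_order2 with n, order_le_pd, HG. }
  assert (key : forall i p z, (i < n)%nat ->
    (pd (W [i]) F1 p
      + sumR (seq 0 n) (fun a => pd (X a) (F2 a i) p)
      + sumR (seq 0 n) (fun a => pd (W []) (F2 a i) p * jw p [a]))
    + sumR (seq 0 n) (fun a => sumR (seq 0 n) (fun b =>
        z (insert a [b]) * (pd (W [b]) (F2 a i) p - pd (W [i]) (F2 a b) p))) = 0).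
  { intros i p z Hi.
    pose proof (quasilinear_self_adjoint n F1 F2 f i HF1 HF2 Hsym Hf Hfe Hi
      (set_order2 p z)) as H.
    assert (Hz : forall a b, jw (set_order2 p z) (insert a [b]) = z (insert a [b])).
    { intros a b; cbn [jw set_order2]; now rewrite length_insert. }
    rewrite Hpd in H by auto.
    rewrite (sumR_ext _ _ (fun a => (pd (X a) (F2 a i) p + pd (W []) (F2 a i) p * jw p [a])
       + sumR (seq 0 n) (fun b => z (insert a [b]) * pd (W [b]) (F2 a i) p))) in H.
    2:{ intros a Ha; rewrite in_seq in Ha.
        assert (HFa : smooth n 1 (F2 a i)) by (apply HF2; lia).
        rewrite D_order1, !Hpd by (auto; lia); f_equal.
        apply sumR_ext; intros b _; rewrite Hz, Hpd by auto; ring. }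
    rewrite !sumR_plus in H.
    rewrite (sumR_ext (seq 0 n) (fun a => sumR (seq 0 n) (fun b => _ * jw _ _))
      (fun a => sumR (seq 0 n) (fun b => z (insert a [b]) * pd (W [i]) (F2 a b) p))) in H.
    2:{ intros a Ha; apply sumR_ext; intros b Hb; rewrite in_seq in *.
        rewrite Hz, Hpd by (apply HF2; lia); ring. }
    rewrite (sumR_ext (seq 0 n) (fun a => sumR (seq 0 n) (fun b => _ * (_ - _)))
      (fun a => sumR (seq 0 n) (fun b => z (insert a [b]) * pd (W [b]) (F2 a i) p) +
       (-1) * sumR (seq 0 n) (fun b => z (insert a [b]) * pd (W [i]) (F2 a b) p))).
    2:{ intros a Ha; rewrite <- sumR_scal, <- sumR_plus; apply sumR_ext; intros; ring. }
    rewrite sumR_plus, sumR_scal; lra. }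
  assert (zero : forall i, (i < n)%nat -> forall p,
      pd (W [i]) F1 p
      + sumR (seq 0 n) (fun a => pd (X a) (F2 a i) p)
      + sumR (seq 0 n) (fun a => pd (W []) (F2 a i) p * jw p [a]) = 0).
  { intros i Hi p; specialize (key i p (fun _ => 0) Hi).
    rewrite (sumR_zero (seq 0 n) (fun a => sumR (seq 0 n) (fun b => 0 * _))) in key; [lra|].
    intros a _; apply sumR_zero; intros; ring. }
  split; auto; intros i i' i'' Hi Hi' Hi'' p.
  assert (cyc : forall i a b, (i < n)%nat -> (a < n)%nat -> (b < n)%nat ->
    (pd (W [b]) (F2 a i) p - pd (W [i]) (F2 a b) p) +
    (pd (W [a]) (F2 b i) p - pd (W [i]) (F2 b a) p) = 0).
  { intros j a b Hj Ha Hb.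
    apply (symmetric_part_zero n
      (fun a b => pd (W [b]) (F2 a j) p - pd (W [j]) (F2 a b) p)); auto.
    intros z; specialize (key j p z Hj); rewrite (zero j Hj p) in key; lra. }
  (* The first identity says that twice the derivative of F_{ii'} along w_{i''} is the sum of the
     two other cyclic derivatives; the second is its copy with i' and i'' exchanged. In their
     difference the derivative along w_i cancels, leaving three times the claim. *)
  pose proof (cyc i'' i i' Hi'' Hi Hi'); pose proof (cyc i' i i'' Hi' Hi Hi'').
  rewrite (Hsym i' i), (Hsym i'' i), (Hsym i'' i') in * by auto; lra.
Qed.

(** * Construction of a first-order Lagrangian *)

Lemma euler_order1 (n : nat) (g : jet -> R) (p : jet) : smooth n 1 g ->
  euler n g p = pd (W []) g p - sumR (seq 0 n) (fun i => D n i (pd (W [i]) g) p).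
Proof.
  intros Hg; unfold euler; rewrite (series_eq n 1) by auto using linear_euler_terms.
  rewrite mindices_1; change (sumR ([] :: ?l) ?f) with (f [] + sumR l f).
  rewrite sumR_map; unfold Rminus; f_equal; [simpl; ring|].
  replace (- sumR _ _) with ((-1) * sumR (seq 0 n) (fun i => D n i (pd (W [i]) g) p)) by ring.
  rewrite <- sumR_scal; apply sumR_ext; intros; simpl; ring.
Qed.

Lemma admissible_W (n : nat) (K : list nat) (k : nat) :
  (length K <= k)%nat -> valid n K -> admissible n k (W K).
Proof. intros; now apply in_mindices. Qed.

Lemma valid_singleton (n i : nat) : (i < n)%nat -> valid n [i].
Proof. intros; split; repeat constructor; auto. Qed.

Lemma gradient_exact (n : nat) (v : nat -> jet -> R) :
  (forall i, (i < n)%nat -> smooth n 1 (v i)) ->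
  (forall i j, (i < n)%nat -> (j < n)%nat -> pd (W [i]) (v j) = pd (W [j]) (v i)) ->
  exists g, smooth n 1 g /\ forall i, (i < n)%nat -> pd (W [i]) g = v i.
Proof.
  intros Hv Hc.
  set (L := map (fun i => W [i]) (seq 0 n)).
  assert (HL : forall c, In c L <-> exists i, (i < n)%nat /\ c = W [i]).
  { intros c; unfold L; rewrite in_map_iff; split; intros (i & H1 & H2); exists i;
      rewrite in_seq in *; split; auto; lia. }
  (* The family has to be total on coordinates; on [L] only singleton words occur, so the zero
     branch is a filler. *)
  destruct (closed_family_exact n 1 L) with
    (v := fun c => match c with W [i] => v i | _ => fun _ => 0 end) as (g & Hg & Hgv & _).
  - apply Injective_map_NoDup; [intros i j E; congruence|apply seq_NoDup].
  - intros c Hcc; apply HL in Hcc; destruct Hcc as (i & Hi & ->).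
    apply admissible_W; [simpl; lia|now apply valid_singleton].
  - intros c Hcc; apply HL in Hcc; destruct Hcc as (i & Hi & ->); auto.
  - intros c d Hcc Hd; apply HL in Hcc, Hd.
    destruct Hcc as (i & Hi & ->), Hd as (j & Hj & ->); auto.
  - exists g; split; auto; intros i Hi; apply (Hgv (W [i])), HL; eauto.
Qed.

Lemma first_order_lagrangian (n : nat) (F1 : jet -> R) (F2 : nat -> nat -> jet -> R) :
  smooth n 1 F1 ->
  (forall a b, (a < n)%nat -> (b < n)%nat -> smooth n 1 (F2 a b)) ->
  (forall a b, (a < n)%nat -> (b < n)%nat -> F2 a b = F2 b a) ->
  (forall i i' i'', (i < n)%nat -> (i' < n)%nat -> (i'' < n)%nat -> forall p,
      pd (W [i'']) (F2 i i') p = pd (W [i']) (F2 i i'') p) ->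
  (forall i', (i' < n)%nat -> forall p,
      pd (W [i']) F1 p
      + sumR (seq 0 n) (fun i => pd (X i) (F2 i i') p)
      + sumR (seq 0 n) (fun i => pd (W []) (F2 i i') p * jw p [i]) = 0) ->
  exists g, smooth n 1 g /\ euler n g = quasilinear n F1 F2.
Proof.
  intros HF1 HF2 Hsym HA HB.
  (* The first condition says that each row of (F_ij) is closed in the variables w_j, so row i has a
     potential V_i. Outside the range [F1] is a placeholder that makes the choice of [V] total. *)
  assert (HVex : forall i, exists V, (i < n)%nat -> smooth n 1 V /\
            forall j, (j < n)%nat -> pd (W [j]) V = F2 i j).
  { intros i; destruct (lt_dec i n) as [Hi|Hi]; [|exists F1; tauto].
    destruct (gradient_exact n (F2 i)) as (V & HV & HVj); auto; [|now exists V].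
    intros j k Hj Hk; extensionality p; now apply HA. }
  set (V i := proj1_sig (constructive_indefinite_description _ (HVex i))).
  assert (HV : forall i, (i < n)%nat -> smooth n 1 (V i)).
  { intros i; apply (proj2_sig (constructive_indefinite_description _ (HVex i))). }
  assert (HVj : forall i j, (i < n)%nat -> (j < n)%nat -> pd (W [j]) (V i) = F2 i j).
  { intros i j Hi; apply (proj2_sig (constructive_indefinite_description _ (HVex i))); auto. }
  clearbody V; clear HVex.
  (* Closedness of the family V_i is exactly the symmetry of F_ij. *)
  destruct (gradient_exact n V) as (g0 & Hg0 & Hg0V); auto.
  { intros i j Hi Hj; rewrite !HVj; auto. }
  assert (V0 : admissible n 1 (W [])).
  { apply admissible_W; [simpl; lia|split; constructor]. }
  assert (Hw : forall i, (i < n)%nat -> smooth n 1 (fun p => jw p [i])).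
  { intros i Hi; apply (smooth_coord n 1 (W [i])), admissible_W;
      [simpl; lia|now apply valid_singleton]. }
  set (S := fun p => sumR (seq 0 n) (fun i =>
              pd (X i) (V i) p + pd (W []) (V i) p * jw p [i])).
  (* Since V_i is the derivative of [g0] along w_i, E g0 equals its w-derivative minus [S] minus the
     second-order part. So [h] is precisely what a correction independent of the w_i must have as
     w-derivative. *)
  set (h := fun p => F1 p + ((-1) * pd (W []) g0 p + S p)).
  assert (Hh : smooth n 1 h).
  { apply smooth_plus; auto; apply smooth_plus; [now apply smooth_scal, smooth_pd|].
    apply smooth_sumR; intros i Hi; rewrite in_seq in Hi.
    apply smooth_plus; [apply smooth_pd, HV; lia|].
    apply smooth_mult; [apply smooth_pd, HV|apply Hw]; lia. }
  (* By the second condition the remainder [h] does not depend on the first derivatives. *)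
  assert (Hh0 : forall j, (j < n)%nat -> pd (W [j]) h = fun _ => 0).
  { intros j Hj.
    assert (HS : dlim (W [j]) S (fun p => sumR (seq 0 n) (fun i =>
       pd (X i) (F2 i j) p + (pd (W []) (F2 i j) p * jw p [i]
       + pd (W []) (V i) p * (if coord_dec (W [i]) (W [j]) then 1 else 0))))).
    { apply dlim_sumR; intros i Hi; rewrite in_seq in Hi.
      assert (Hi' : (i < n)%nat) by lia.
      rewrite <- (HVj i j Hi' Hj).
      rewrite (pd_comm n 1 (X i)), (pd_comm n 1 (W [])) by auto.
      apply dlim_plus; [|apply dlim_mult; [|apply (dlim_coord (W [j]) (W [i]))]];
        apply smooth_dlim with n 1%nat; now apply smooth_pd, HV. }
    rewrite (dlim_pd _ h _ (dlim_plus _ _ _ _ _ (smooth_dlim n 1 _ F1 HF1)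
      (dlim_plus _ _ _ _ _ (dlim_scal _ (-1) _ _ (smooth_dlim n 1 _ _
         (smooth_pd n 1 (W []) g0 Hg0))) HS))).
    extensionality p; rewrite (pd_comm n 1 (W [j]) (W [])), Hg0V by auto.
    (* Differentiating the factor w_i in [S] along w_j yields the w-derivative of V_j, which cancels
       the contribution of [g0]; the rest is the left-hand side of the second condition. *)
    rewrite <- (HB j Hj p) at 1; rewrite !sumR_plus.
    rewrite (sumR_ext _ (fun i => pd (W []) (V i) p * _)
      (fun i => if Nat.eq_dec j i then pd (W []) (V i) p else 0)).
    - rewrite sumR_seq_delta by auto; ring.
    - intros i _; destruct (coord_dec (W [i]) (W [j])), (Nat.eq_dec j i);
        try congruence; ring. }
  set (g1 := prim (W []) h).
  assert (Hg1 : smooth n 1 g1) by now apply smooth_prim.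
  exists (fun p => g0 p + g1 p); split; [now apply smooth_plus|].
  assert (Epd : forall c, pd c (fun p => g0 p + g1 p) = fun p => pd c g0 p + pd c g1 p).
  { intros c; apply dlim_pd, dlim_plus; now apply smooth_dlim with n 1%nat. }
  assert (Eg1 : pd (W []) g1 = h)
    by (apply dlim_pd, dlim_prim_same with n 1%nat; now apply smooth_cont).
  extensionality p; rewrite euler_order1 by now apply smooth_plus.
  rewrite Epd, Eg1.
  rewrite (sumR_ext _ _ (fun i => (pd (X i) (V i) p + pd (W []) (V i) p * jw p [i])
            + sumR (seq 0 n) (fun b => F2 i b p * jw p (insert i [b])))).
  - rewrite sumR_plus; unfold h, quasilinear; fold (S p); ring.
  - intros i Hi; rewrite in_seq in Hi.
    assert (Hi' : (i < n)%nat) by lia.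
    replace (pd (W [i]) (fun q => g0 q + g1 q)) with (V i).
    + rewrite D_order1 by auto; f_equal; apply sumR_ext; intros b Hb; rewrite in_seq in Hb.
      rewrite HVj; auto; lia.
    + rewrite Epd, Hg0V by auto; unfold g1.
      rewrite (pd_prim_zero n 1) by first [discriminate | auto].
      extensionality q; ring.
Qed.

Theorem theorem3p2 (n : nat) (F1 : jet -> R) (F2 : nat -> nat -> jet -> R)
  (hF1 : smooth n 1 F1)
  (hF2 : forall i i', (i < n)%nat -> (i' < n)%nat -> smooth n 1 (F2 i i'))
  (hsym : forall i i', (i < n)%nat -> (i' < n)%nat -> F2 i i' = F2 i' i) :
  let RHS := fun p => F1 p - sumR (seq 0 n) (fun i => sumR (seq 0 n)
               (fun i' => F2 i i' p * jw p (insert i [i']))) in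
  (exists (k : nat) (f : jet -> R), smooth n k f /\ forall p, EL n k f p = RHS p) ->
  (forall i i' i'', (i < n)%nat -> (i' < n)%nat -> (i'' < n)%nat -> forall p,
      pd (W [i'']) (F2 i i') p = pd (W [i']) (F2 i i'') p) /\
  (forall i', (i' < n)%nat -> forall p,
      pd (W [i']) F1 p
      + sumR (seq 0 n) (fun i => pd (X i) (F2 i i') p)
      + sumR (seq 0 n) (fun i => pd (W []) (F2 i i') p * jw p [i]) = 0) /\
  (exists g : jet -> R, smooth n 1 g /\ forall p, EL n 1 g p = RHS p).
Proof.
  intros RHS (k & f & Hf & Hfe).
  assert (He : euler n f = quasilinear n F1 F2).
  { rewrite <- (EL_euler n k f Hf); extensionality p; apply Hfe. }
  destruct (helmholtz_conditions n F1 F2 f hF1 hF2 hsym) as [HA HB]; auto; [now exists k|].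
  split; [exact HA|split; [exact HB|]].
  destruct (first_order_lagrangian n F1 F2 hF1 hF2 hsym HA HB) as (g & Hg & Hge).
  exists g; split; auto; intros p; rewrite (EL_euler n 1 g Hg), Hge; reflexivity.
Qed.
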